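(* Let $\mathcal{A}(z)$, $A(k)$, $\lambda_A^j$, $\mathcal{P}_{\mathcal{A}}$ and its normalized irreducible factors $\mathcal{P}^1_{\mathcal{A}},\dots,\mathcal{P}^K_{\mathcal{A}}$ be as in the context. Let $\alpha\in\mathbb{R}^d$ with $\alpha\neq 0_d \bmod \mathbb{Z}^d$. Then: (1) $\mathcal{P}_{\mathcal{A}}(z,\lambda)$ satisfies condition $C_\alpha$ if and only if the set $$S_1(\alpha)=\{k\in\mathbb{R}^d:\ \text{there exist } s,w\in\{1,\dots,Q\} \text{ such that } \lambda_A^s(k+\alpha)=\lambda_A^w(k)\}$$ has Lebesgue measure zero; (2) $\mathcal{P}_{\mathcal{A}}(z,\lambda)$ is square-free if and only if the set $$S_2=\{k\in\mathbb{R}^d:\ \text{there exist distinct } s,w\in\{1,\dots,Q\} \text{ such that } \lambda_A^s(k)=\lambda_A^w(k)\}$$ has Lebesgue measure zero.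
   Context: Let $d,Q\ge1$ and $\mathbb{C}^\star=\mathbb{C}\setminus\{0\}$. Let $\mathcal{A}(z)$ be a $Q\times Q$ matrix each of whose entries is a Laurent polynomial in $z=(z_1,\dots,z_d)\in(\mathbb{C}^\star)^d$ with complex coefficients. Set $A(k)=\mathcal{A}(z)$ with $z_j=e^{2\pi i k_j}$, $k\in\mathbb{R}^d$, and assume $A(k)$ is Hermitian for every $k\in\mathbb{R}^d$. Denote by $\lambda_A^1(k)\le\lambda_A^2(k)\le\cdots\le\lambda_A^Q(k)$ the eigenvalues of $A(k)$ in non-decreasing order (spectral band functions). For $\eta,\zeta\in\mathbb{C}^d$ let $\eta\odot\zeta=(\eta_1\zeta_1,\dots,\eta_d\zeta_d)$; $0_d=(0,\dots,0)$, $1_d=(1,\dots,1)$. Let $\mathcal{P}_{\mathcal{A}}(z,\lambda)=\det(\mathcal{A}(z)-\lambda I_{Q\times Q})$, a Laurent polynomial in $z$ and polynomial in $\lambda$, and write $\mathcal{P}_{\mathcal{A}}(z,\lambda)=(-1)^Q\prod_{l=1}^K\mathcal{P}^l_{\mathcal{A}}(z,\lambda)$ where each $\mathcal{P}^l_{\mathcal{A}}$ is a non-monomial irreducible factor (in the ring of Laurent polynomials in $z$, polynomials in $\lambda$), normalized so that it is a Laurent polynomial in $z$, a polynomial in $\lambda$, and its coefficient of the highest power of $\lambda$ equals $1$ (factors repeated with multiplicity). $\mathcal{P}_{\mathcal{A}}$ is called square-free if $\mathcal{P}^{l_1}_{\mathcal{A}}\not\equiv\mathcal{P}^{l_2}_{\mathcal{A}}$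 for all distinct $l_1,l_2\in\{1,\dots,K\}$. For $\alpha\in\mathbb{R}^d$ with $\alpha\ne0_d\bmod\mathbb{Z}^d$, set $\zeta=(e^{2\pi i\alpha_1},\dots,e^{2\pi i\alpha_d})$; $\mathcal{P}_{\mathcal{A}}$ satisfies condition $C_\alpha$ if for all $l_1,l_2\in\{1,\dots,K\}$ (possibly equal), $\mathcal{P}^{l_1}_{\mathcal{A}}(z,\lambda)\not\equiv\mathcal{P}^{l_2}_{\mathcal{A}}(\zeta\odot z,\lambda)$. *)

(* Defs.v *)
(* MathComp + MathComp-Analysis (trigo) + real_closed (complex numbers). *)
From HB Require Import structures.
From mathcomp Require Import all_boot all_order all_algebra.
From mathcomp Require Import reals trigo.
From mathcomp Require Import complex.

Set Implicit Arguments.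
Unset Strict Implicit.
Unset Printing Implicit Defensive.

Import Order.TTheory GRing.Theory Num.Theory.
Local Open Scope ring_scope.

Section Defs.
Variables (R : realType) (d Q : nat).

(* The complex numbers C = R[i]. *)
Local Notation C := (complex R).

(* Points z of (C\{0})^d. *)
Definition in_torus (z : 'I_d -> C) : Prop := forall j, z j != 0.

(* z^m = prod_j z_j^{m_j}, m in Z^d *)
Definition laurent_monomial (m : 'I_d -> int) (z : 'I_d -> C) : C :=
  \prod_(j < d) z j ^ m j.

(* A Laurent polynomial in z (with complex coefficients), viewed as the
   function it defines on (C\{0})^d: a finite sum of terms c z^m. *)
Definition is_laurent (f : ('I_d -> C) -> C) : Prop :=
  exists s : seq (C * ('I_d -> int)),
    forall z, in_torus z -> f z = \sum_(t <- s) t.1 * laurent_monomial t.2 z.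

(* Elements of the ring of Laurent polynomials in z and polynomials in lambda,
   viewed as functions on (C\{0})^d x C. *)
Definition is_LP (F : ('I_d -> C) -> C -> C) : Prop :=
  exists (n : nat) (c : nat -> ('I_d -> C) -> C),
    (forall i, is_laurent (c i)) /\
    forall z lam, in_torus z -> F z lam = \sum_(i < n) c i z * lam ^+ i.

(* Normalization: the coefficient of the highest power of lambda equals 1. *)
Definition LP_monic (F : ('I_d -> C) -> C -> C) : Prop :=
  exists (n : nat) (c : nat -> ('I_d -> C) -> C),
    (forall i, is_laurent (c i)) /\
    forall z lam, in_torus z -> F z lam = lam ^+ n + \sum_(i < n) c i z * lam ^+ i.

(* Identical equality of two such elements. *)
Definition LP_eq (F G : ('I_d -> C) -> C -> C) : Prop :=
  forall z lam, in_torus z -> F z lam = G z lam.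

(* Units of the ring. *)
Definition LP_unit (F : ('I_d -> C) -> C -> C) : Prop :=
  is_LP F /\ exists G, is_LP G /\ forall z lam, in_torus z -> F z lam * G z lam = 1.

(* Irreducible elements (non-zero, non-unit, no non-trivial factorization);
   in particular non-monomial, the monomials c z^m (c <> 0) being the units. *)
Definition LP_irreducible (F : ('I_d -> C) -> C -> C) : Prop :=
  [/\ is_LP F, ~ LP_unit F &
      forall G H, is_LP G -> is_LP H -> LP_eq F (fun z lam => G z lam * H z lam) ->
                  LP_unit G \/ LP_unit H].

(* Matrix of Laurent polynomials, evaluated at z. *)
Definition mx_eval (A : 'M[('I_d -> C) -> C]_Q) (z : 'I_d -> C) : 'M[C]_Q :=
  \matrix_(i, j) A i j z.

(* P_A(z, lambda) = det(A(z) - lambda I). *)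
Definition PA (A : 'M[('I_d -> C) -> C]_Q) (z : 'I_d -> C) (lam : C) : C :=
  \det (mx_eval A z - lam%:M).

(* (-1)^Q prod_l P^l_A is a factorization of P_A into normalized
   non-monomial irreducible factors. *)
Definition irreducible_factorization (A : 'M[('I_d -> C) -> C]_Q)
    (K : nat) (P : 'I_K -> ('I_d -> C) -> C -> C) : Prop :=
  (forall l, LP_irreducible (P l) /\ LP_monic (P l)) /\
  LP_eq (PA A) (fun z lam => (-1) ^+ Q * \prod_(l < K) P l z lam).

Definition square_free (K : nat) (P : 'I_K -> ('I_d -> C) -> C -> C) : Prop :=
  forall l1 l2 : 'I_K, l1 != l2 -> ~ LP_eq (P l1) (P l2).

(* e^{2 pi i t} *)
Definition cexp2pi (t : R) : C := (cos (2 * pi * t) +i* sin (2 * pi * t))%C.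

(* z = (e^{2 pi i k_1}, ..., e^{2 pi i k_d}) *)
Definition torus_pt (k : 'rV[R]_d) : 'I_d -> C := fun j => cexp2pi (k 0 j).

Definition condition_C (alpha : 'rV[R]_d) (K : nat)
    (P : 'I_K -> ('I_d -> C) -> C -> C) : Prop :=
  let zeta := torus_pt alpha in
  forall l1 l2 : 'I_K,
    ~ LP_eq (P l1) (fun z lam => P l2 (fun j => zeta j * z j) lam).

(* A(k) *)
Definition Ak (A : 'M[('I_d -> C) -> C]_Q) (k : 'rV[R]_d) : 'M[C]_Q :=
  mx_eval A (torus_pt k).

Definition hermitian_mx (M : 'M[C]_Q) : Prop :=
  forall i j, M j i = ((M i j)^*)%C.

(* ev lists the eigenvalues of M (roots of the characteristic polynomial,
   with multiplicity) in non-decreasing order: ev i = lambda^{i+1}. *)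
Definition ordered_eigenvalues (M : 'M[C]_Q) (ev : 'I_Q -> R) : Prop :=
  (forall i j : 'I_Q, (i <= j)%N -> ev i <= ev j) /\
  char_poly M = \prod_(i < Q) ('X - ((ev i)%:C)%C%:P).

(* S_1(alpha) *)
Definition S1 (A : 'M[('I_d -> C) -> C]_Q) (alpha : 'rV[R]_d) (k : 'rV[R]_d) : Prop :=
  exists ev1 ev2, ordered_eigenvalues (Ak A (k + alpha)) ev1 /\
                  ordered_eigenvalues (Ak A k) ev2 /\
                  exists s w : 'I_Q, ev1 s = ev2 w.

(* S_2 *)
Definition S2 (A : 'M[('I_d -> C) -> C]_Q) (k : 'rV[R]_d) : Prop :=
  exists ev, ordered_eigenvalues (Ak A k) ev /\
             exists s w : 'I_Q, s != w /\ ev s = ev w.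

(* Lebesgue null sets in R^d: coverable by countably many closed boxes of
   arbitrarily small total volume. *)
Definition lebesgue_null (S : 'rV[R]_d -> Prop) : Prop :=
  forall eps : R, 0 < eps ->
  exists a b : nat -> 'rV[R]_d,
    (forall n j, a n 0 j <= b n 0 j) /\
    (forall k, S k -> exists n, forall j, a n 0 j <= k 0 j <= b n 0 j) /\
    (forall N, \sum_(n < N) \prod_(j < d) (b n 0 j - a n 0 j) <= eps).

End Defs.

(* Main.v *)
(* After multiplication by a power of z_1...z_d, the factors P^l live in
   C[z_1,...,z_d][lambda].  Two of them having a common root for every z share a
   factor over C(z); as C[z_1,...,z_d] is factorial, Gauss's lemma brings this
   factorization back to polynomials, and irreducibility makes the two factors
   equal.  Hence if P^l and P^l'(zeta .) are distinct, Bezout's identity yields a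
   nonzero polynomial r(z) vanishing whenever they have a common root, and the
   exceptional set lies in the zero set of r on the real torus; P^l and its
   lambda-derivative are treated in the same way.  This zero set is null: on each
   coset of the grid of M-th roots of unity, r is small at a proportion O(1/M) of
   the points only, and a fine mesh of cells turns this count into a covering of
   volume O(1/M).  Conversely, two equal factors give a coincidence of eigenvalues
   at every k, and the whole space is not null. *)
Require Import Defs.
From HB Require Import structures.
From mathcomp Require Import all_boot all_order all_algebra.
From mathcomp Require Import all_classical all_reals all_analysis.
From mathcomp Require Import measurable_realfun measurable_fun_approximation.
From mathcomp Require Import complex ring lra.
Import numFieldNormedType.Exports.
Import Order.TTheory GRing.Theory Num.Theory.
Local Open Scope ring_scope.
Set Implicit Arguments.
Unset Strict Implicit.
Unset Printing Implicit Defensive.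


(** * Gauss: polynomials over a factorial domain form a factorial domain *)

Section Factoriality.

Implicit Types R : idomainType.

(** Elements of the ring are given as functions on the torus, while gcds, Gauss's lemma and Bezout
    concern formal polynomials. The passage is safe because a polynomial vanishing on the torus is
    zero, and because z_1...z_d is a unit there, so clearing a power of it only multiplies by a
    unit. The normalization does double duty: the numerator of a factor has a power of z_1...z_d as
    leading coefficient, which vanishes nowhere on the torus. So the degree in lambda is the same at
    every z, each factor has a root at every k, and associate factors are equal, not merely
    proportional. The proportion O(1/M) comes from the last variable: unless the leading coefficient
    of r is small, which is the induction, only boundedly many of its M values make r small. Small
    values are counted instead of zeros because a cell that meets the zero set need not have a zero
    at its corner; a Lipschitz bound makes the value there small. The threshold must not depend on
    the coset, since the number of cosets is chosen after it. *)

Definition divides R (p a : R) := exists q, a = p * q.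

Definition prime_like R (p : R) :=
  p != 0 /\ forall a b, divides p (a * b) -> divides p a \/ divides p b.

Definition prime_factored R (a : R) :=
  exists2 ps : seq R, {in ps, forall p, prime_like p} & a = \prod_(p <- ps) p.

Definition factorial_ring R := forall a : R, a != 0 -> prime_factored a.

Lemma prime_like_unit R (u : R) : u \is a GRing.unit -> prime_like u.
Proof.
move=> uu; split; first by apply: contraTneq uu => ->; rewrite unitr0.
by move=> a b _; left; exists (u^-1 * a); rewrite mulrA divrr ?mul1r.
Qed.

Lemma prime_factored1 R (p : R) : prime_like p -> prime_factored p.
Proof.
by move=> hp; exists [:: p]; rewrite ?big_seq1 // => x; rewrite inE => /eqP ->.
Qed.

Lemma prime_factoredM R (a b : R) :
  prime_factored a -> prime_factored b -> prime_factored (a * b).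
Proof.
move=> [ps hps ->] [qs hqs ->]; exists (ps ++ qs); last by rewrite big_cat.
by move=> x; rewrite mem_cat => /orP[/hps|/hqs].
Qed.

Lemma field_factorial (F : fieldType) : factorial_ring F.
Proof.
by move=> a a0; apply/prime_factored1/prime_like_unit; rewrite unitfE.
Qed.

Lemma dividesC_coef R (p : R) (f : {poly R}) i :
  divides p%:P f -> divides p f`_i.
Proof. by move=> [q ->]; exists q`_i; rewrite coefCM. Qed.

Lemma dividesD R (p a b : R) : divides p a -> divides p b -> divides p (a + b).
Proof. by move=> [q ->] [r ->]; exists (q + r); rewrite mulrDr. Qed.

Lemma dividesMr R (p a b : R) : divides p a -> divides p (a * b).
Proof. by move=> [q ->]; exists (q * b); rewrite mulrA. Qed.

Lemma divides_prod R (p : R) (ps : seq R) : ~ p \is a GRing.unit ->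
  prime_like p -> divides p (\prod_(x <- ps) x) ->
  exists2 x, x \in ps & divides p x.
Proof.
move=> up [p0 hp]; elim: ps => [|x ps IH].
  rewrite big_nil => -[q e]; case: up; apply/unitrPr; exists q; by rewrite e.
rewrite big_cons => /hp[hx|/IH[y hy hxy]]; first by exists x; rewrite ?mem_head.
by exists y; rewrite // inE hy orbT.
Qed.

Lemma size_split R (g : {poly R}) : g != 0 ->
  exists2 g1 : {poly R}, (size g1 < size g)%N &
    g = (lead_coef g)%:P * 'X^((size g).-1) + g1.
Proof.
move=> g0; exists (take_poly (size g).-1 g).
  by rewrite (leq_ltn_trans (size_take_poly _ _)) // prednK ?size_poly_gt0.
apply/polyP => i; rewrite coefD coefCM coefXn coef_take_poly.
case: (ltngtP i (size g).-1) => h; rewrite ?mulr0 ?add0r ?mulr1 ?addr0 //.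
  by rewrite nth_default //; case: (size g) h.
by rewrite h.
Qed.

(** Gauss's lemma. If p divides f g, it divides the product of the leading coefficients, hence one
    of them; removing that leading term preserves the divisibility and lowers the sum of the
    sizes. *)
Lemma prime_like_polyC R (p : R) : prime_like p -> prime_like (p%:P : {poly R}).
Proof.
move=> [p0 hp]; split; first by rewrite polyC_eq0.
move=> f g; have [n] := ubnP (size f + size g); elim: n f g => // n IH f g szn hfg.
have [->|f0] := eqVneq f 0; first by left; exists 0; rewrite mulr0.
have [->|g0] := eqVneq g 0; first by right; exists 0; rewrite mulr0.
have [|[q hq]|[q hq]] := hp (lead_coef f) (lead_coef g).
- by rewrite -lead_coefM /lead_coef; apply: dividesC_coef.
- have [f1 sf ef] := size_split f0.
  have d1 : divides p%:P ((lead_coef f)%:P * 'X^((size f).-1)).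
    by exists (q%:P * 'X^((size f).-1)); rewrite hq polyCM mulrA.
  have [||h|h] := IH f1 g.
  + by rewrite -ltnS (leq_trans _ szn) // ltnS ltn_add2r.
  + have -> : f1 * g = f * g + - ((lead_coef f)%:P * 'X^((size f).-1)) * g.
      by rewrite -mulrDl {1}ef addrAC subrr add0r.
    apply: dividesD => //; apply: dividesMr; case: d1 => r ->.
    by exists (- r); rewrite mulrN.
  + by left; rewrite ef; apply: dividesD.
  + by right.
have [g1 sg eg] := size_split g0.
have d1 : divides p%:P ((lead_coef g)%:P * 'X^((size g).-1)).
  by exists (q%:P * 'X^((size g).-1)); rewrite hq polyCM mulrA.
have [||h|h] := IH f g1.
- by rewrite -ltnS (leq_trans _ szn) // ltnS ltn_add2l.
- have -> : f * g1 = f * g + - ((lead_coef g)%:P * 'X^((size g).-1)) * f.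
    by rewrite mulrC [f * g]mulrC -mulrDl {1}eg addrAC subrr add0r.
  apply: dividesD => //; apply: dividesMr; case: d1 => r ->.
  by exists (- r); rewrite mulrN.
- by left.
by right; rewrite eg; apply: dividesD.
Qed.

Lemma polyZI R (a : R) : a != 0 -> injective ( *:%R a : {poly R} -> {poly R}).
Proof.
by move=> a0 f g /eqP; rewrite -!mul_polyC => /eqP/mulfI; apply; rewrite polyC_eq0.
Qed.

(* Clearing the denominators of a factorization over the fraction field. *)
Lemma clear_denominator R (c : R) (f g h : {poly R}) :
  prime_factored c -> c *: f = g * h ->
  exists c1 c2 (g' h' : {poly R}),
    [/\ c = c1 * c2, g = c1 *: g', h = c2 *: h' & f = g' * h'].
Proof.
move=> [ps hps ->]; elim: ps hps f g h => [|p ps IH] hps f g h.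
  by rewrite big_nil scale1r => ->; exists 1, 1, g, h; rewrite !scale1r mulr1.
rewrite big_cons -scalerA => e.
have [p0 hp] := prime_like_polyC (hps p (mem_head _ _)).
have ips : {in ps, forall q, prime_like q}.
  by move=> q hq; apply: hps; rewrite inE hq orbT.
rewrite polyC_eq0 in p0.
have [|[g1 eg]|[h1 eh]] := hp g h.
- by rewrite -e -mul_polyC; exists (\prod_(x <- ps) x *: f).
- have e1 : \prod_(x <- ps) x *: f = g1 * h.
    by apply: (polyZI p0); rewrite e eg mul_polyC scalerAl.
  have [c1 [c2 [g' [h' [-> e2 -> ->]]]]] := IH ips _ _ _ e1.
  by exists (p * c1), c2, g', h'; rewrite mulrA eg e2 mul_polyC scalerA.
have e1 : \prod_(x <- ps) x *: f = g * h1.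
  by apply: (polyZI p0); rewrite e eh mul_polyC scalerAr.
have [c1 [c2 [g' [h' [-> -> e2 ->]]]]] := IH ips _ _ _ e1.
by exists c1, (p * c2), g', h'; rewrite mulrCA eh e2 mul_polyC scalerA.
Qed.

(** The first hypothesis is primitivity of f in the form in which it is used: a constant prime
    dividing a multiple of f divides the cofactor. The denominator a is thus cancelled prime by
    prime. *)
Lemma primitive_divides R (a : R) (f q g : {poly R}) :
  (forall p, prime_like p -> forall r, divides p%:P (f * r) -> divides p%:P r) ->
  prime_factored a -> a != 0 -> f * q = a *: g -> divides f g.
Proof.
move=> hf [ps hps ->]; elim: ps hps q g => [|p ps IH] hps q g.
  by rewrite big_nil scale1r => _ <-; exists q.
rewrite big_cons mulf_eq0 negb_or => /andP[p0 ps0] e.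
have [|r er] := hf p (hps p (mem_head _ _)) q.
  by rewrite e -scalerA -mul_polyC; exists (\prod_(j <- ps) j *: g).
apply: (IH _ r) => //; first by move=> x hx; apply: hps; rewrite inE hx orbT.
by apply: (polyZI p0); rewrite scalerA -e er mulrCA mul_polyC.
Qed.

(** Two nested inductions. Splittings into factors of smaller size are handled by induction on the
    size; when there is none, constant primes are pulled out by induction on the number of primes in
    the leading coefficient. What is left is primitive and unsplittable, and is shown to be
    prime. *)
Lemma factorial_poly R : factorial_ring R -> factorial_ring {poly R}.
Proof.
move=> fR f; have [n] := ubnP (size f); elim: n f => // n IHn f szn f0.
have [fc|fgt1] := leqP (size f) 1.
  have c0 : f`_0 != 0 by rewrite -polyC_eq0 -size1_polyC.
  have [ps hps e] := fR _ c0.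
  exists [seq p%:P | p <- ps]; last by rewrite big_map -rmorph_prod -e; exact: size1_polyC.
  by move=> x /mapP[p /hps hp ->]; apply: prime_like_polyC.
have [[g [h [e sg sh]]]|noS] :=
  EM (exists g h, [/\ f = g * h, (size g < size f)%N & (size h < size f)%N]).
  have g0 : g != 0 by apply: contraNneq f0 => g0; rewrite e g0 mul0r.
  have h0 : h != 0 by apply: contraNneq f0 => h0; rewrite e h0 mulr0.
  by rewrite e; apply: prime_factoredM; apply: IHn => //; move: szn; rewrite ltnS; apply: leq_trans.
have lf0 : lead_coef f != 0 by rewrite lead_coef_eq0.
have [ps hps el] := fR _ lf0.
have [m] := ubnP (size ps); elim: m f ps hps el lf0 noS fgt1 f0 {szn} => // m IHm.
move=> f ps hps el lf0 noS fgt1 f0 szm.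
have [[p pps [f1 ef]]|noP] := EM (exists2 p, p \in ps & divides p%:P f).
  have p0 : p != 0 by case: (hps p pps).
  have sf1 : size f = size f1 by rewrite ef mul_polyC size_scale.
  have f10 : f1 != 0 by apply: contraNneq f0 => h; rewrite ef h mulr0.
  rewrite ef; apply: prime_factoredM.
    exact/prime_factored1/prime_like_polyC/hps.
  apply: (IHm f1 (rem p ps)).
  - by move=> x /mem_rem; apply: hps.
  - apply: (mulfI p0); rewrite -lead_coefZ -mul_polyC -ef el.
    by rewrite (big_rem p pps).
  - by rewrite lead_coef_eq0.
  - move=> [g [h [e1 sg sh]]]; apply: noS; exists (p *: g), h.
    by rewrite size_scale // sf1 -scalerAl -e1 -mul_polyC.
  - by rewrite -sf1.
  - exact: f10.
  - by rewrite size_rem // -ltnS (leq_trans _ szm) // prednK //; case: (ps) pps.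
(* [noP] excludes only the primes listed in [ps]. A nonunit prime p dividing f divides the leading
   coefficient, hence some x in [ps]; as x is prime and p is no unit, x divides p and therefore f,
   which [noP] forbids. *)
have primf p : prime_like p -> forall r, divides p%:P (f * r) -> divides p%:P r.
  move=> hp r; have [up|nup] := boolP (p \is a GRing.unit).
    by exists (p^-1%:P * r); rewrite mulrA -polyCM divrr // mul1r.
  case: (prime_like_polyC hp) => _ hpP /hpP[hf|//]; case: noP.
  have : divides p (\prod_(x <- ps) x) by rewrite -el; apply: dividesC_coef.
  case/(divides_prod (negP nup) hp) => x xps [t ext]; exists x => //.
  have [x0 hx] := hps x xps.
  have [|[s es]|[s es]] := hx p t; first by exists 1; rewrite mulr1.
    case: hf => q ->; exists (s%:P * q).
    by rewrite mulrA -polyCM -es.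
  case/negP: nup; apply/unitrPr; exists s.
  by apply: (mulfI x0); rewrite mulrCA -es mulr1 -ext.
apply: prime_factored1; split=> // g h [q e].
have strip a k r : a != 0 -> a *: k = r * f -> divides f k.
  move=> a0 ea; apply: (primitive_divides (a := a) (q := r)) => //; last first.
    by rewrite mulrC.
  exact: fR.
have [cfg|ncfg] := boolP (coprimep f g).
  right; have : f %| h by rewrite -(Gauss_dvdpr _ cfg) e dvdp_mulr.
  by case/Pdiv.Idomain.dvdpP => -[a r] /= a0 ea; apply: strip ea.
(* The gcd over the fraction field is now nonconstant. Cleared of denominators it gives a true
   factor [e1] of f, of full size by [noS]; so f is associate to the gcd and divides g up to a
   constant, which [strip] removes. *)
left; have := dvdp_gcdl f g; case/Pdiv.Idomain.dvdpP => -[c r] /= c0 ec.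
have [c1 [c2 [r' [e1 [ecc er ee ef]]]]] := clear_denominator (fR _ c0) ec.
have [c10 c20] : c1 != 0 /\ c2 != 0.
  by apply/andP; rewrite -negb_or -mulf_eq0 -ecc.
have se1 : size (gcdp f g) = size e1 by rewrite ee size_scale.
have e1gt1 : (1 < size e1)%N.
  rewrite -se1 ltn_neqAle eq_sym -coprimep_def ncfg /= size_poly_gt0.
  by rewrite gcdp_eq0 negb_and f0.
have r0 : r' != 0 by apply: contraNneq f0 => h0; rewrite ef h0 mul0r.
have e0 : e1 != 0 by rewrite -size_poly_gt0 (ltn_trans _ e1gt1).
have sf : size f = (size r' + size e1).-1 by rewrite ef size_mul.
have lr : (size r' < size f)%N.
  by rewrite sf; case: (size e1) e1gt1 => [|[|k]] //= _; rewrite addnS /= addnS ltnS leq_addr.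
have le : (size f <= size e1)%N.
  by rewrite leqNgt; apply/negP => le; apply: noS; exists r', e1.
have : f %| g.
  apply: dvdp_trans (dvdp_gcdr f g).
  rewrite -(eqp_dvdl _ (d1 := gcdp f g)) //.
  rewrite -dvdp_size_eqp ?dvdp_gcdl //; rewrite se1 eqn_leq le andbT.
  by rewrite -se1 dvdp_leq // dvdp_gcdl.
by case/Pdiv.Idomain.dvdpP => -[a k] /= a0 ea; apply: strip ea.
Qed.

End Factoriality.


(** * Polynomials in n variables as iterated univariate polynomials *)

Section IteratedPolynomials.

(** Adjoining one variable at a time reduces factoriality, and each later induction on n, to a
    statement on univariate polynomials. *)
Fixpoint iter_poly (F : fieldType) (n : nat) : idomainType :=
  if n is m.+1 then {poly iter_poly F m} else F.

Lemma iter_poly_factorial (F : fieldType) n : factorial_ring (iter_poly F n).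
Proof. by elim: n => [|n IH]; [exact: field_factorial | exact: factorial_poly]. Qed.

Fixpoint ieval (F : fieldType) (n : nat) (z : nat -> F) :
    {rmorphism iter_poly F n -> F} :=
  match n return {rmorphism iter_poly F n -> F} with
  | 0 => idfun
  | m.+1 => horner_eval (z m) \o map_poly (ieval m z)
  end.

Lemma ievalS (F : fieldType) n (z : nat -> F) (p : {poly iter_poly F n}) :
  ieval n.+1 z p = (map_poly (ieval n z) p).[z n].
Proof. by []. Qed.

Lemma ieval_ext (F : fieldType) n (z w : nat -> F) :
  (forall j, (j < n)%N -> z j = w j) -> ieval n z =1 ieval n w.
Proof.
elim: n => [|n IH] zw p //; rewrite !ievalS zw //.
by congr (_.[_]); apply: eq_map_poly; apply: IH => j jn; apply: zw; rewrite ltnW.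
Qed.

Lemma poly_vanish (F : numFieldType) (p : {poly F}) :
  (forall x, x != 0 -> p.[x] = 0) -> p = 0.
Proof.
move=> hp; apply/eqP; apply: contraTT isT => p0.
have := @max_poly_roots _ p [seq i.+1%:R | i <- iota 0 (size p)] p0.
rewrite size_map size_iota ltnn; apply.
  by apply/allP => x /mapP[i _ ->]; rewrite /root hp ?pnatr_eq0.
rewrite map_inj_uniq ?iota_uniq // => i j /eqP.
by rewrite eqr_nat => /eqP[].
Qed.

Lemma polyCeq (F : numFieldType) (p q : {poly F}) :
  (forall x, p.[x] = q.[x]) -> p = q.
Proof.
move=> h; apply/eqP; rewrite -subr_eq0; apply/eqP/poly_vanish => x _.
by rewrite hornerD hornerN h subrr.
Qed.

(** This recovers formal identities from equalities of functions on the torus. Nonzero coordinates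
    suffice, as 1, 2, 3, ... are already too many roots for a nonzero univariate polynomial. *)
Lemma ieval_vanish (F : numFieldType) n (p : iter_poly F n) :
  (forall z : nat -> F, (forall j, (j < n)%N -> z j != 0) -> ieval n z p = 0) ->
  p = 0.
Proof.
elim: n p => [|n IH] p hp; first by have := hp (fun=> 1); apply.
apply/polyP => i; rewrite coef0; apply: IH => z hz.
have -> : ieval n z (p : {poly _})`_i = (map_poly (ieval n z) p)`_i.
  by rewrite coef_map.
suff -> : map_poly (ieval n z) p = 0 by rewrite coef0.
apply: poly_vanish => x x0.
pose w j := if j == n then x else z j.
have wn : w n = x by rewrite /w eqxx.
have wz : ieval n w =1 ieval n z.
  by apply: ieval_ext => j jn; rewrite /w ltn_eqF.
rewrite -wn -(eq_map_poly wz) -ievalS hp // => j.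
by rewrite ltnS leq_eqVlt /w; case: eqP => //= _; apply: hz.
Qed.

Lemma ieval_const (F : fieldType) n (c : F) :
  exists p : iter_poly F n, forall z, ieval n z p = c.
Proof.
elim: n => [|n [p hp]]; first by exists c.
by exists p%:P => z; rewrite ievalS map_polyC hornerC /= hp.
Qed.

Lemma ieval_var (F : fieldType) n j : (j < n)%N ->
  exists p : iter_poly F n, forall z, ieval n z p = z j.
Proof.
elim: n => [//|n IH]; rewrite ltnS leq_eqVlt => /orP[/eqP->|/IH[p hp]].
  by exists 'X => z; rewrite ievalS map_polyX hornerX.
by exists p%:P => z; rewrite ievalS map_polyC hornerC /= hp.
Qed.

End IteratedPolynomials.

(** * Laurent polynomials and their polynomial numerators *)

Section LaurentClosure.
Variables (R : realType) (d : nat).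
Local Notation C := (complex R).
Implicit Types (f g : ('I_d -> C) -> C) (F G : ('I_d -> C) -> C -> C).

Lemma laurent_ext f g : (forall z, in_torus z -> f z = g z) ->
  is_laurent f -> is_laurent g.
Proof. by move=> e [s hs]; exists s => z hz; rewrite -e // hs. Qed.

Lemma laurent_monomialD m1 m2 (z : 'I_d -> C) : in_torus z ->
  laurent_monomial (fun j => m1 j + m2 j) z =
  laurent_monomial m1 z * laurent_monomial m2 z.
Proof.
move=> hz; rewrite /laurent_monomial -big_split /=; apply: eq_bigr => j _.
by rewrite expfzDr // hz.
Qed.

Lemma laurent_mono (c : C) m : is_laurent (fun z : 'I_d -> C => c * laurent_monomial m z).
Proof. by exists [:: (c, m)] => z _; rewrite big_seq1. Qed.

Lemma laurent_const (c : C) : is_laurent (fun _ : 'I_d -> C => c).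
Proof.
apply: laurent_ext (laurent_mono c (fun=> 0)) => z hz.
by rewrite /laurent_monomial big1 ?mulr1 // => j _; rewrite expr0z.
Qed.

Lemma laurentD f g : is_laurent f -> is_laurent g ->
  is_laurent (fun z => f z + g z).
Proof.
by move=> [s hs] [t ht]; exists (s ++ t) => z hz; rewrite big_cat /= hs // ht.
Qed.

Lemma laurentM f g : is_laurent f -> is_laurent g ->
  is_laurent (fun z => f z * g z).
Proof.
move=> [s hs] [t ht].
exists [seq (x.1 * y.1, fun j => x.2 j + y.2 j) | x <- s, y <- t] => z hz.
rewrite hs // ht // big_allpairs_dep /= mulr_suml; apply: eq_bigr => x _.
rewrite mulr_sumr; apply: eq_bigr => y _.
by rewrite laurent_monomialD // mulrACA.
Qed.

Lemma laurent_sum n (f : nat -> ('I_d -> C) -> C) :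
  (forall i, (i < n)%N -> is_laurent (f i)) ->
  is_laurent (fun z => \sum_(i < n) f i z).
Proof.
elim: n => [|n IH] hf.
  by apply: laurent_ext (laurent_const 0) => z _; rewrite big_ord0.
apply: laurent_ext (laurentD (IH _) (hf n _)) => // [z _|i hi].
  by rewrite big_ord_recr.
by apply: hf; rewrite ltnW.
Qed.

Lemma laurentX f n : is_laurent f -> is_laurent (fun z => f z ^+ n).
Proof.
move=> hf; elim: n => [|n IH].
  by apply: laurent_ext (laurent_const 1) => z _; rewrite expr0.
by apply: laurent_ext (laurentM hf IH) => z _; rewrite exprS.
Qed.

Lemma laurent_var j : is_laurent (fun z : 'I_d -> C => z j).
Proof.
apply: laurent_ext (laurent_mono 1 (fun i => (i == j)%:R)) => z hz.
rewrite mul1r /laurent_monomial (bigD1 j) //= eqxx expr1z big1 ?mulr1 //.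
by move=> i /negPf ->; rewrite expr0z.
Qed.

Definition prod_coord (z : 'I_d -> C) := \prod_j z j.

Lemma prod_coord_neq0 z : in_torus z -> prod_coord z != 0.
Proof. by move=> hz; apply/prodf_neq0 => j _. Qed.

Lemma laurent_prod_coordV n : is_laurent (fun z => (prod_coord z ^+ n)^-1).
Proof.
apply: laurent_ext (laurentX n (laurent_mono 1 (fun=> -1))) => z hz.
rewrite mul1r -exprVn /laurent_monomial /prod_coord -prodfV.
by congr (_ ^+ _); apply: eq_bigr => j _; rewrite exprN1.
Qed.

(** The default 1 is nonzero and of modulus 1, so padding keeps a point on the complex or real
    torus. *)
Definition extend (z : 'I_d -> C) : nat -> C :=
  fun j => if insub j is Some i then z i else 1.

Lemma extendE z (j : 'I_d) : extend z j = z j.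
Proof. by rewrite /extend valK. Qed.

Lemma extendK (w : nat -> C) j : (j < d)%N ->
  extend (fun i : 'I_d => w i) j = w j.
Proof. by move=> hj; rewrite -[j in LHS]/(val (Ordinal hj)) extendE. Qed.

Lemma laurent_ieval n (p : iter_poly C n) : (n <= d)%N ->
  is_laurent (fun z => ieval n (extend z) p).
Proof.
elim: n p => [|n IH] p hn; first exact: laurent_const.
have h := laurent_sum (n := size p) (f := fun i z =>
  ieval n (extend z) ((p : {poly _})`_i) * extend z n ^+ i).
apply: laurent_ext (h _) => [z _|i _].
  rewrite ievalS (@horner_coef_wide _ (size p)) ?size_poly //.
  by apply: eq_bigr => k _; rewrite coef_map.
apply: laurentM; first by apply: IH; rewrite ltnW.
apply/laurentX/(laurent_ext _ (laurent_var (Ordinal hn))) => z _.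
by rewrite -(extendE z (Ordinal hn)).
Qed.

Local Notation poly_d := (iter_poly C d).
Definition teval (z : 'I_d -> C) : {rmorphism poly_d -> C} := ieval d (extend z).

Lemma teval_vanish (p : poly_d) :
  (forall z, in_torus z -> teval z p = 0) -> p = 0.
Proof.
move=> hp; apply: ieval_vanish => w hw.
rewrite -(hp (fun i : 'I_d => w i)); last by move=> j; apply: hw.
by apply: ieval_ext => j jd; rewrite extendK.
Qed.

Lemma coord_numer j : exists p : poly_d, forall z, teval z p = z j.
Proof.
have [p hp] := @ieval_var C d j (ltn_ord j).
by exists p => z; rewrite /teval hp extendE.
Qed.

Lemma prod_coord_numer (r : seq 'I_d) (Q : pred 'I_d) :
  exists p : poly_d, forall z, teval z p = \prod_(j <- r | Q j) z j.
Proof.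
elim: r => [|j r [p hp]]; first by exists 1 => z; rewrite rmorph1 big_nil.
have [q hq] := coord_numer j.
exists (if Q j then q * p else p) => z; rewrite big_cons.
by case: ifP => _; rewrite ?rmorphM /= hp ?hq.
Qed.

Definition mon : poly_d :=
  sval (cid (prod_coord_numer (index_enum _) xpredT)).

Lemma teval_mon z : teval z mon = prod_coord z.
Proof. by rewrite /mon; case: cid => /= p ->. Qed.

Lemma mon_neq0 : mon != 0.
Proof.
apply/eqP => h; have := teval_mon (fun=> 1); rewrite h rmorph0 => /esym/eqP.
by apply/negP/prod_coord_neq0 => j; rewrite oner_eq0.
Qed.

Definition numer f (M : nat) (p : poly_d) :=
  forall z, in_torus z -> prod_coord z ^+ M * f z = teval z p.

Definition has_numer f := exists M p, numer f M p.

Lemma has_numer_ext f g : (forall z, in_torus z -> f z = g z) ->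
  has_numer f -> has_numer g.
Proof. by move=> e [M [p h]]; exists M, p => z hz; rewrite -e // h. Qed.

Lemma numer_shift f M N p : numer f M p -> numer f (N + M) (mon ^+ N * p).
Proof.
by move=> h z hz; rewrite exprD -mulrA h // rmorphM rmorphXn /= teval_mon.
Qed.

Lemma has_numer_const (c : C) : has_numer (fun=> c).
Proof.
have [p hp] := ieval_const d c; exists 0%N, p => z _.
by rewrite mul1r /teval hp.
Qed.

Lemma has_numerD f g : has_numer f -> has_numer g ->
  has_numer (fun z => f z + g z).
Proof.
move=> [M [p hp]] [N [q hq]]; exists (M + N)%N, (mon ^+ N * p + mon ^+ M * q).
move=> z hz; rewrite mulrDr rmorphD /= -(numer_shift _ hp) //.
by rewrite -(numer_shift _ hq) // addnC.
Qed.

Lemma has_numerM f g : has_numer f -> has_numer g ->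
  has_numer (fun z => f z * g z).
Proof.
move=> [M [p hp]] [N [q hq]]; exists (M + N)%N, (p * q) => z hz.
by rewrite rmorphM /= -hp // -hq // exprD mulrACA.
Qed.

Lemma has_numerX f n : has_numer f -> has_numer (fun z => f z ^+ n).
Proof.
move=> hf; elim: n => [|n IH].
  by apply: has_numer_ext (has_numer_const 1) => z _; rewrite expr0.
by apply: has_numer_ext (has_numerM hf IH) => z _; rewrite exprS.
Qed.

(** The inverse of a coordinate is the product of the others divided by the product of all; this is
    why powers of the single monomial [mon] suffice as denominators. *)
Lemma has_numer_coord j (n : int) : has_numer (fun z => z j ^ n).
Proof.
case: n => n.
  apply: (has_numerX (f := fun z => z j)).
  by have [p hp] := coord_numer j; exists 0%N, p => z _; rewrite mul1r hp.
have : has_numer (fun z => (z j)^-1).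
  have [p hp] := prod_coord_numer (index_enum _) (fun i => i != j).
  exists 1%N, p => z hz; rewrite hp expr1 /prod_coord (bigD1 j) //=.
  by rewrite mulrAC divff ?mul1r // hz.
move/(has_numerX n.+1); apply: has_numer_ext => z hz.
by rewrite NegzE -exprnN exprVn.
Qed.

Lemma laurent_numer f : is_laurent f -> has_numer f.
Proof.
move=> [s hs]; apply: (has_numer_ext (f := fun z =>
  \sum_(t <- s) t.1 * laurent_monomial t.2 z)) => [z hz|]; first by rewrite hs.
elim: s {hs} => [|t s IH].
  by apply: has_numer_ext (has_numer_const 0) => z _; rewrite big_nil.
apply: has_numer_ext (has_numerD _ IH) => [z _|]; first by rewrite big_cons.
apply: has_numerM (has_numer_const _) _; rewrite /laurent_monomial.
elim: (index_enum _) => [|j r IHr].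
  by apply: has_numer_ext (has_numer_const 1) => z _; rewrite big_nil.
apply: has_numer_ext (has_numerM (has_numer_coord j _) IHr) => z _.
by rewrite big_cons.
Qed.

Lemma laurent_common_numer (c : nat -> ('I_d -> C) -> C) n :
  (forall i, is_laurent (c i)) ->
  exists M (p : nat -> poly_d), forall i, (i < n)%N -> numer (c i) M (p i).
Proof.
move=> hc; elim: n => [|n [M [p hp]]]; first by exists 0%N, (fun=> 0).
have [N [q hq]] := laurent_numer (hc n).
exists (N + M)%N, (fun i => if i == n then mon ^+ M * q else mon ^+ N * p i).
move=> i; rewrite ltnS leq_eqVlt; case: eqP => [-> _|_ /= hi].
  by rewrite addnC; apply: numer_shift.
by apply: numer_shift; apply: hp.
Qed.

Definition peval z : {rmorphism {poly poly_d} -> {poly C}} := map_poly (teval z).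

Definition lp_numer F M (p : {poly poly_d}) :=
  forall z lam, in_torus z -> prod_coord z ^+ M * F z lam = (peval z p).[lam].

Lemma peval_inj (p q : {poly poly_d}) :
  (forall z lam, in_torus z -> (peval z p).[lam] = (peval z q).[lam]) -> p = q.
Proof.
move=> h; apply/polyP => i; apply/eqP; rewrite -subr_eq0; apply/eqP.
apply: teval_vanish => z hz; rewrite rmorphB /= -!(coef_map (teval z)).
have -> : map_poly (teval z) p = map_poly (teval z) q.
  by apply: polyCeq => x; apply: h.
by rewrite subrr.
Qed.

Lemma LP_numer F : is_LP F -> exists M p, lp_numer F M p.
Proof.
move=> [n [c [hc hF]]]; have [M [p hp]] := laurent_common_numer n hc.
exists M, (\poly_(i < n) p i) => z lam hz; rewrite hF // mulr_sumr.
rewrite (@horner_coef_wide _ n); last first.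
  by rewrite (leq_trans (size_poly _ _)) // size_poly.
apply: eq_bigr => i _.
by rewrite mulrA hp // coef_map coef_poly ltn_ord.
Qed.

Lemma lp_numer_LP M (p : {poly poly_d}) :
  is_LP (fun z lam => (prod_coord z ^+ M)^-1 * (peval z p).[lam]).
Proof.
exists (size p), (fun i z => (prod_coord z ^+ M)^-1 * teval z p`_i); split=> [i|].
  by apply: laurentM (laurent_prod_coordV M) (laurent_ieval _ _).
move=> z lam hz; rewrite (@horner_coef_wide _ (size p)) ?size_poly //.
by rewrite mulr_sumr; apply: eq_bigr => i _; rewrite coef_map mulrA.
Qed.

(** The leading coefficient [mon ^+ M] has no zero on the torus, so specializing z never lowers the
    degree in lambda. *)
Lemma LP_monic_numer F : LP_monic F -> exists n M p,
  [/\ lp_numer F M p, size p = n.+1, lead_coef p = mon ^+ M &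
   forall z, in_torus z -> size (peval z p) = n.+1].
Proof.
move=> [n [c [hc hF]]]; have [M [p hp]] := laurent_common_numer n hc.
pose q := mon ^+ M *: 'X^n + \poly_(i < n) p i.
have m0 : mon ^+ M != 0 by rewrite expf_neq0 // mon_neq0.
have s1 : size (mon ^+ M *: 'X^n : {poly poly_d}) = n.+1.
  by rewrite size_scale // size_polyXn.
have sq : size q = n.+1 by rewrite size_polyDl s1 // ltnS size_poly.
have lq : lead_coef q = mon ^+ M.
  rewrite lead_coefDl ?s1 ?ltnS ?size_poly //.
  by rewrite lead_coefZ lead_coefXn mulr1.
exists n, M, q; split=> // z.
  move=> lam hz; rewrite hF // mulrDr rmorphD hornerD; congr (_ + _).
    by rewrite /= map_polyZ hornerZ map_polyXn hornerXn /= rmorphXn /= teval_mon.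
  rewrite (@horner_coef_wide _ n); last first.
    by rewrite (leq_trans (size_poly _ _)) // size_poly.
  rewrite mulr_sumr; apply: eq_bigr => i _.
  by rewrite mulrA hp // coef_map coef_poly ltn_ord.
move=> hz; rewrite /peval size_poly_eq ?sq // -[n]/(n.+1.-1) -sq -/(lead_coef q).
by rewrite lq rmorphXn /= teval_mon expf_neq0 // prod_coord_neq0.
Qed.

(** * Units and irreducible elements, read on their numerators *)

Lemma LP_unit_numer F M p : LP_unit F -> lp_numer F M p -> (size p <= 1)%N.
Proof.
move=> [_ [G [/LP_numer[N [q hq]] FG]]] hp.
have e : p * q = (mon ^+ (M + N))%:P.
  apply: peval_inj => z lam hz; rewrite rmorphM hornerM -hp // -hq //.
  rewrite mulrACA FG // mulr1 -exprD /peval /= map_polyC hornerC /=.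
  by rewrite rmorphXn /= teval_mon.
have m0 : mon ^+ (M + N) != 0 by rewrite expf_neq0 // mon_neq0.
have pq0 : p * q != 0 by rewrite e polyC_eq0.
have := congr1 (fun r : {poly poly_d} => size r) e.
move: pq0; rewrite mulf_eq0 negb_or => /andP[p0 q0].
rewrite size_mul // size_polyC m0 /= => h.
rewrite leqNgt; apply/negP => sp; move: h; rewrite -(size_poly_gt0 q) in q0.
by case: (size p) sp => [|[|k]] //= _; case: (size q) q0 => [|l] //= _; rewrite addnS.
Qed.

(** Irreducibility over the fraction field. Clearing c gives a factorization of p itself, hence one
    of F once [g1] absorbs the power of z_1...z_d; a factor of positive degree in lambda is not a
    unit. *)
Lemma LP_irreducible_split F M (p g h : {poly poly_d}) c :
  LP_irreducible F -> lp_numer F M p -> c != 0 -> c *: p = g * h ->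
  (1 < size g)%N -> (size h <= 1)%N.
Proof.
move=> [_ _ irrF] hp c0 e sg.
have [c1 [c2 [g1 [h1 [ec eg eh ep]]]]] :=
  clear_denominator (iter_poly_factorial c0) e.
have [c10 c20] : c1 != 0 /\ c2 != 0.
  by apply/andP; rewrite -negb_or -mulf_eq0 -ec.
have [] := irrF _ _ (lp_numer_LP M g1) (lp_numer_LP 0 h1).
- move=> z lam hz; rewrite expr0 invr1 mul1r -mulrA -hornerM -rmorphM -ep.
  by rewrite -hp // mulKf // expf_neq0 // prod_coord_neq0.
- move=> /(LP_unit_numer (M := M) (p := g1)) h1s.
  move: sg; rewrite eg size_scale // ltnNge h1s // => z lam hz.
  by rewrite mulVKf // expf_neq0 // prod_coord_neq0.
move=> /(LP_unit_numer (M := 0) (p := h1)); rewrite eh size_scale //; apply.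
by move=> z lam hz; rewrite expr0 invr1 !mul1r.
Qed.

(** Over the fraction field p is the gcd times a cofactor, which [LP_irreducible_split] makes
    constant; so p is associate to the gcd. Here [%|] is divisibility up to a nonzero constant of
    the coefficient ring. *)
Lemma LP_irreducible_gcd F M (p q : {poly poly_d}) :
  LP_irreducible F -> lp_numer F M p -> p != 0 -> (1 < size (gcdp p q))%N ->
  p %| q.
Proof.
move=> irrF hp p0 sg.
have /Pdiv.Idomain.dvdpP[[c r] /= c0 ec] := dvdp_gcdl p q.
have sr : (size r <= 1)%N.
  by apply: (LP_irreducible_split irrF hp c0 _ sg); rewrite mulrC.
apply: dvdp_trans (dvdp_gcdr p q).
rewrite -(eqp_dvdl _ (d1 := gcdp p q)) // -dvdp_size_eqp ?dvdp_gcdl //.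
have g0 : gcdp p q != 0 by rewrite -size_poly_gt0 ltnW.
rewrite -(size_scale p c0) ec (size1_polyC sr) mul_polyC size_scale //.
rewrite -polyC_eq0 -size1_polyC //; apply: contraTneq c0 => r0.
by move/eqP: ec; rewrite r0 mul0r scale_poly_eq0 (negPf p0) orbF => ->.
Qed.

Lemma LP_unit1 F : (forall z lam, in_torus z -> F z lam = 1) -> LP_unit F.
Proof.
have L1 (G : ('I_d -> C) -> C -> C) :
    (forall z lam, in_torus z -> G z lam = 1) -> is_LP G.
  move=> h; exists 1%N, (fun _ _ => 1); split=> [_|z lam hz]; first exact: laurent_const.
  by rewrite big_ord1 h // mulr1.
move=> h; split; first exact: L1.
exists (fun _ _ => 1); split; first exact: L1.
by move=> z lam hz; rewrite h // mulr1.
Qed.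

Lemma irreducible_monic_size F M p : LP_irreducible F -> lp_numer F M p ->
  lead_coef p = mon ^+ M -> (1 < size p)%N.
Proof.
move=> [_ nu _] hp lp; rewrite ltnNge; apply/negP => sp; apply: nu.
apply: LP_unit1 => z lam hz.
have m0 : prod_coord z ^+ M != 0 by rewrite expf_neq0 // prod_coord_neq0.
apply: (mulfI m0); rewrite hp // mulr1 (size1_polyC sp) /peval /= map_polyC.
rewrite hornerC; have -> : p`_0 = mon ^+ M.
  by move: lp; rewrite (size1_polyC sp) lead_coefC coefC.
by rewrite /= rmorphXn /= teval_mon.
Qed.

(** Each numerator divides the other over the fraction field; comparing leading coefficients shows
    that their ratio is exactly the ratio of the two denominators. *)
Lemma LP_irreducible_eq F G M N (p q : {poly poly_d}) :
  LP_irreducible F -> LP_irreducible G -> lp_numer F M p -> lp_numer G N q ->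
  lead_coef p = mon ^+ M -> lead_coef q = mon ^+ N ->
  (1 < size (gcdp p q))%N -> LP_eq F G.
Proof.
move=> irrF irrG hp hq lp lq sg.
have mM : mon ^+ M != 0 by rewrite expf_neq0 // mon_neq0.
have mN : mon ^+ N != 0 by rewrite expf_neq0 // mon_neq0.
have p0 : p != 0 by rewrite -lead_coef_eq0 lp.
have q0 : q != 0 by rewrite -lead_coef_eq0 lq.
have pq := LP_irreducible_gcd irrF hp p0 sg.
have qp : q %| p.
  apply: (LP_irreducible_gcd irrG hq q0).
  by rewrite (eqp_size (gcdpC _ _)).
have /eqpP[[c1 c2] /= /andP[c10 c20] e] : p %= q by rewrite /eqp pq qp.
have el : c1 * mon ^+ M = c2 * mon ^+ N.
  by have := congr1 lead_coef e; rewrite !lead_coefZ lp lq.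
have e2 : mon ^+ N *: p = mon ^+ M *: q.
  apply: (polyZI c10); rewrite !scalerA el mulrC -scalerA e scalerA.
  by rewrite mulrC.
move=> z lam hz.
have hm : prod_coord z ^+ (N + M) != 0.
  by rewrite expf_neq0 // prod_coord_neq0.
apply: (mulfI hm); rewrite {1}exprD -mulrA hp // addnC exprD -mulrA hq //.
have := congr1 (fun r => (peval z r).[lam]) e2.
by rewrite /peval /= !map_polyZ !hornerZ !rmorphXn /= teval_mon.
Qed.

(** Otherwise p would divide its derivative, which has smaller degree and, in characteristic zero,
    is nonzero. *)
Lemma LP_irreducible_separable F M (p : {poly poly_d}) :
  LP_irreducible F -> lp_numer F M p -> lead_coef p = mon ^+ M ->
  ~~ (1 < size (gcdp p p^`()))%N.
Proof.
move=> irrF hp lp; apply/negP => sg.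
have sp := irreducible_monic_size irrF hp lp.
have p0 : p != 0 by rewrite -size_poly_gt0 ltnW.
have := LP_irreducible_gcd irrF hp p0 sg.
have c0 : (deriv p)`_(size p).-2 != 0.
  rewrite coef_deriv prednK; last by case: (size p) sp => [|[]].
  rewrite -/(lead_coef p) lp.
  (* Evaluation at (1, ..., 1) carries the integer multiple of [mon ^+ M] to a complex number, where
     it is visibly nonzero. *)
  apply/eqP => h; have /eqP := congr1 (teval (fun=> 1)) h.
  rewrite rmorphMn rmorphXn rmorph0 /= teval_mon mulrn_eq0.
  rewrite expf_eq0 (negPf (prod_coord_neq0 _)) ?andbF ?orbF.
    by case: (size p) sp => [|[]].
  by move=> j; rewrite oner_eq0.
have d0 : p^`() != 0 by apply: contraNneq c0 => ->; rewrite coef0.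
move=> /(dvdp_leq d0); rewrite leqNgt => /negP; apply.
exact: lt_size_deriv.
Qed.

End LaurentClosure.


(** * Counting the grid points at which a polynomial is small *)

Lemma card_dep_pair (A B : finType) (T : A -> {set B}) :
  #|[set y : A * B | y.2 \in T y.1]| = (\sum_a #|T a|)%N.
Proof.
rewrite -sum1_card (eq_bigl (fun y => xpredT y.1 && (y.2 \in T y.1))) => [|y].
  rewrite -(pair_big_dep xpredT (fun a b => b \in T a) (fun _ _ => 1%N)) /=.
  by apply: eq_bigr => a _; rewrite sum1_card.
by rewrite inE.
Qed.

Section SmallValues.
Variable F : numFieldType.

Lemma pos_lower_bound2 (a b : F) : 0 < a -> 0 < b ->
  exists2 c, 0 < c & c <= a /\ c <= b.
Proof.
move=> a0 b0; have /orP[h|h] := real_leVge (gtr0_real a0) (gtr0_real b0).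
  by exists a.
by exists b.
Qed.

Lemma pos_lower_bound (I : eqType) (s : seq I) (f : I -> F) :
  (forall i, i \in s -> 0 < f i) ->
  exists2 c, 0 < c & forall i, i \in s -> c <= f i.
Proof.
elim: s => [|i s IH] hf; first by exists 1.
have [|c c0 hc] := IH; first by move=> j js; apply: hf; rewrite inE js orbT.
have [b b0 [bc bi]] := pos_lower_bound2 c0 (hf i (mem_head _ _)).
exists b => // j; rewrite inE => /orP[/eqP->//|/hc]; exact: le_trans.
Qed.

(** Quantitative form of: size at most n and n distinct roots imply zero. The quotient q of p -
    p(x0) by X - x0 has values at most 2 delta / sigma at the other points, so the induction applies
    to it. *)
Lemma coef_bound_of_values n (sigma eps : F) : 0 < sigma -> 0 < eps ->
  exists2 delta, 0 < delta & forall (p : {poly F}) (s : seq F),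
    (size p <= n)%N -> (n <= size s)%N -> uniq s ->
    (forall x, x \in s -> `|x| <= 1) ->
    (forall x y, x \in s -> y \in s -> x != y -> sigma <= `|x - y|) ->
    (forall x, x \in s -> `|p.[x]| <= delta) ->
    forall m, `|p`_m| <= eps.
Proof.
move=> s0; elim: n eps => [|n IH] eps e0.
  exists 1 => // p s; rewrite leqn0 size_poly_eq0 => /eqP -> *.
  by rewrite coef0 normr0 ltW.
(* A coefficient of p involves two coefficients of q, each given eps / 4, and possibly p(x0), given
   eps / 2. The bound sigma * d1 / 2 on delta keeps the values of q below [d1]. *)
have [|d1 d10 hd] := IH (eps / 4%:R); first by rewrite divr_gt0 // ltr0n.
have [||d d0 [dle dls]] := @pos_lower_bound2 (eps / 2%:R) (sigma * d1 / 2%:R).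
- by rewrite divr_gt0 // ltr0n.
- by rewrite divr_gt0 ?mulr_gt0 // ltr0n.
exists d => // p [//|x0 s] sp ss us hs1 hsep hp m.
have /factor_theorem[q eq] : root (p - (p.[x0])%:P) x0.
  by rewrite /root hornerD hornerN hornerC subrr.
have ep : p = q * ('X - x0%:P) + (p.[x0])%:P by rewrite -eq subrK.
have sq : (size q <= n)%N.
  have [->|q0] := eqVneq q 0; first by rewrite size_poly0.
  have sqX : size (q * ('X - x0%:P)) = (size q).+1.
    by rewrite size_Mmonic ?monicXsubC // size_XsubC addn2.
  rewrite -ltnS -sqX.
  rewrite -eq.
  rewrite (leq_trans (size_polyD _ _)) // geq_max sp size_polyN.
  by rewrite (leq_trans (size_polyC_leq1 _)).
have x0s : x0 \in x0 :: s by rewrite mem_head.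
have mems x : x \in s -> x \in x0 :: s by rewrite inE orbC => ->.
have /andP[x0ns us'] : uniq (x0 :: s) by [].
have hq k : `|q`_k| <= eps / 4%:R.
  apply: (hd q s) => // [x /mems/hs1//|x y /mems hx /mems hy|x xs].
    exact: hsep.
  have xx0 : x != x0 by apply: contraNneq x0ns => <-.
  have nx0 : x - x0 != 0 by rewrite subr_eq0.
  have sx : sigma <= `|x - x0| by apply: hsep => //; apply: mems.
  have -> : q.[x] = (p.[x] - p.[x0]) / (x - x0).
    rewrite {1}ep hornerD hornerC addrK hornerM hornerXsubC mulfK //.
  rewrite normrM normfV ler_pdivrMr ?normr_gt0 //.
  apply: le_trans (ler_normB _ _) _.
  apply: le_trans (lerD (hp _ (mems _ xs)) (hp _ x0s)) _.
  apply: le_trans (lerD dls dls) _.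
  by rewrite -splitr mulrC ler_wpM2l // ltW.
have e4 : eps / 4%:R + eps / 4%:R + eps / 2%:R = eps by field.
rewrite ep coefD mulrBr coefB coefMX coefMC coefC -[leRHS]e4.
apply: le_trans (ler_normD _ _) _; apply: lerD; last first.
  case: eqP => _; first exact: le_trans (hp _ x0s) dle.
  by rewrite normr0 ltW // divr_gt0 // ltr0n.
apply: le_trans (ler_normB _ _) _; apply: lerD.
  by case: eqP => // _; rewrite normr0 ltW // divr_gt0 // ltr0n.
rewrite normrM -[leRHS]mulr1 ler_pM // ?hs1 //.
Qed.

(** When [rt] lists the M-th roots of unity and x varies, this runs over the coset of z under the
    grid. *)
Definition grid_pt M (rt : 'I_M -> F) n (z : nat -> F) (x : {ffun 'I_n -> 'I_M})
    (j : nat) : F :=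
  z j * (if insub j is Some i then rt (x i) else 1).

(* D does not depend on M, nor delta on z: this is the Schwartz-Zippel bound,
   made uniform over all cosets of the finite grid. *)
Lemma grid_small_count n (r : iter_poly F n) : r != 0 ->
  exists D : nat, forall M (rt : 'I_M -> F),
    injective rt -> (forall t, `|rt t| = 1) ->
    exists2 delta, 0 < delta & forall z : nat -> F, (forall j, `|z j| = 1) ->
      (M * #|[set x : {ffun 'I_n -> 'I_M} | (`|ieval n (grid_pt rt z x) r| <= delta)%R]|
       <= D * M ^ n)%N.
Proof.
elim: n r => [|n IH] r r0.
  exists 0%N => M rt _ _; exists (`|r| / 2%:R).
    by rewrite divr_gt0 ?normr_gt0 ?ltr0n.
  move=> z _; rewrite mul0n leqn0 muln_eq0; apply/orP; right.
  rewrite cards_eq0; apply/eqP/setP => x; rewrite !inE /=; apply/negP => h.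
  have rp : 0 < `|r| by rewrite normr_gt0.
  move: h; rewrite ler_pdivlMr ?ltr0n // mulrC mulr_natl mulr2n gerDl => h.
  by have := lt_le_trans rp h; rewrite ltxx.
have [D hD] := IH (lead_coef (r : {poly _})) ltac:(by rewrite lead_coef_eq0).
set m := (size (r : {poly _})).-1.
(* [D] accounts for the prefixes at which the leading coefficient is small, [size r] for the last
   coordinates that are bad over any other prefix. *)
exists (D + size (r : {poly _}))%N => M rt irt nrt.
have [d1 d10 hd1] := hD M rt irt nrt.
have [sg sg0 hsg] : exists2 c, 0 < c &
    forall t u : 'I_M, t != u -> c <= `|rt t - rt u|.
  have [|c c0 hc] := @pos_lower_bound _ [seq t <- enum {: 'I_M * 'I_M} | t.1 != t.2]
    (fun t => `|rt t.1 - rt t.2|).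
    move=> t; rewrite mem_filter => /andP[ht _].
    by rewrite normr_gt0 subr_eq0 (inj_eq irt).
  by exists c => // t u tu; apply: (hc (t, u)); rewrite mem_filter tu mem_enum.
have [d d0 hd] := @coef_bound_of_values (size (r : {poly _})) sg (d1 / 2%:R)
  sg0 ltac:(by rewrite divr_gt0 ?ltr0n).
exists d => // z hz.
have d12 : d1 / 2%:R < d1 by rewrite ltr_pdivrMr ?ltr0n // ltr_pMr // ltr1n.
pose rest (x : {ffun 'I_n.+1 -> 'I_M}) : {ffun 'I_n -> 'I_M} :=
  [ffun i => x (widen_ord (leqnSn n) i)].
pose pr x := (rest x, x ord_max).
have pr_inj : injective pr.
  move=> x y [/ffunP exy emax]; apply/ffunP => i.
  have [h|h] := ltnP i n.
    have := exy (Ordinal h); rewrite !ffunE.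
    by congr (x _ = y _); apply: val_inj.
  suff -> : i = ord_max by [].
  by apply/val_inj/eqP; rewrite /= eqn_leq h -ltnS ltn_ord.
pose q (x' : {ffun 'I_n -> 'I_M}) := map_poly (ieval n (grid_pt rt z x')) r.
have qE x : ieval n.+1 (grid_pt rt z x) r = (q (rest x)).[z n * rt (x ord_max)].
  rewrite ievalS; congr (_.[_]).
    apply: eq_map_poly; apply: ieval_ext => j jn; rewrite /grid_pt insubT.
      by rewrite ltnW // ltnS.
    move=> h1; rewrite insubT /= ffunE; congr (_ * rt (x _)); exact: val_inj.
  rewrite /grid_pt insubT //= => h1.
  by congr (_ * rt (x _)); apply: val_inj.
pose bad' := [set x' : {ffun 'I_n -> 'I_M} |
  `|ieval n (grid_pt rt z x') (lead_coef (r : {poly _}))| <= d1].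
pose T x' := [set t : 'I_M | `|(q x').[z n * rt t]| <= d].
(* More than [size r] bad last coordinates would be enough separated points for [hd] to make the
   leading coefficient small, putting the prefix in [bad']. *)
have good x' : x' \notin bad' -> (#|T x'| <= size (r : {poly _}))%N.
  rewrite inE => hx'; rewrite leqNgt; apply/negP => hT; case/negP: hx'.
  pose s := [seq z n * rt t | t <- enum (T x')].
  have zn0 : z n != 0 by rewrite -normr_eq0 hz oner_eq0.
  have := hd (q x') s _ _ _ _ _ _ m; rewrite coef_map => h.
  apply: le_trans (ltW d12); apply: h.
  - exact: size_poly.
  - by rewrite size_map -cardE ltnW.
  - rewrite map_inj_uniq ?enum_uniq // => t u /(mulfI zn0); exact: irt.
  - by move=> x /mapP[t _ ->]; rewrite normrM hz nrt mulr1.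
  - move=> x y /mapP[t _ ->] /mapP[u _ ->] xy.
    rewrite -mulrBr normrM hz mul1r hsg //; by apply: contraNneq xy => ->.
  - by move=> x /mapP[t]; rewrite mem_enum inE => ht ->.
have card_le : (#|[set x : {ffun 'I_n.+1 -> 'I_M} |
    (`|ieval n.+1 (grid_pt rt z x) r| <= d)%R]| <= \sum_x' #|T x'|)%N.
  rewrite -(card_imset _ pr_inj).
  rewrite -card_dep_pair.
  apply/subset_leq_card/fintype.subsetP => y /imsetP[x]; rewrite inE qE => hx ->.
  by rewrite !inE.
apply: leq_trans (leq_mul (leqnn M) card_le) _.
have -> : ((D + size (r : {poly _})) * M ^ n.+1 =
   M * (D * M ^ n + size (r : {poly _}) * M ^ n))%N.
  by rewrite expnS -mulnDl mulnCA.
rewrite leq_mul2l; apply/orP; right; rewrite (bigID (mem bad')) /=; apply: leq_add.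
  apply: leq_trans (hd1 z hz); rewrite mulnC -/bad' -sum_nat_const.
  by apply: leq_sum => x' _; rewrite -[leqRHS]card_ord max_card.
rewrite mulnC; have -> : (M ^ n = #|{ffun 'I_n -> 'I_M}|)%N.
  by rewrite card_ffun !card_ord.
rewrite -sum_nat_const; apply: (@leq_trans (\sum_(x' | x' \notin bad') size (r : {poly _}))%N).
  by apply: leq_sum => x' /good.
by rewrite big_mkcond /=; apply: leq_sum => x' _; case: ifP.
Qed.

(** The bound on values and the Lipschitz constant are built together, because the difference of two
    products needs a bound on one of the factors. *)
Lemma ieval_lipschitz n (r : iter_poly F n) :
  exists B L : F, [/\ 0 <= B, 0 <= L & forall (z w : nat -> F) eta,
    0 <= eta -> (forall j, `|z j| <= 1) -> (forall j, `|w j| <= 1) ->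
    (forall j, (j < n)%N -> `|z j - w j| <= eta) ->
    `|ieval n z r| <= B /\ `|ieval n z r - ieval n w r| <= L * eta].
Proof.
elim: n r => [|n IH] r.
  exists `|r|, 0; split=> // z w eta *; split=> //=.
  by rewrite subrr normr0 mul0r.
elim/(@poly_ind (iter_poly F n)): r => [|p c [Bp [Lp [Bp0 Lp0 hp]]]].
  exists 0, 0; split=> // z w eta *; rewrite !rmorph0.
  by rewrite subrr normr0 mul0r.
have [Bc [Lc [Bc0 Lc0 hc]]] := IH c.
exists (Bp + Bc), (Lp + Bp + Lc); split; rewrite ?addr_ge0 //.
move=> z w eta e0 hz hw hzw.
have [p1 p2] := hp z w eta e0 hz hw hzw.
(* The value bound speaks of the first point only; the pair (w, w) gives it at w. *)
have [p3 _] := hp w w eta e0 hw hw ltac:(by move=> j _; rewrite subrr normr0).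
have hzw' j : (j < n)%N -> `|z j - w j| <= eta.
  by move=> jn; apply: hzw; rewrite ltnW.
have [c1 c2] := hc z w eta e0 hz hw hzw'.
have E y : ieval n.+1 y (p * 'X + c%:P) = ieval n.+1 y p * y n + ieval n y c.
  by rewrite !ievalS rmorphD rmorphM /= map_polyX map_polyC hornerMXaddC.
rewrite !E; split.
  apply: le_trans (ler_normD _ _) _; apply: lerD => //.
  by rewrite normrM -[leRHS]mulr1 ler_pM.
have -> : ieval n.+1 z p * z n + ieval n z c - (ieval n.+1 w p * w n + ieval n w c)
  = (ieval n.+1 z p - ieval n.+1 w p) * z n + ieval n.+1 w p * (z n - w n)
    + (ieval n z c - ieval n w c) by ring.
rewrite [leRHS]mulrDl [(_ + _) * eta]mulrDl.
apply: le_trans (ler_normD _ _) _; apply: lerD => //.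
apply: le_trans (ler_normD _ _) _; apply: lerD; rewrite normrM.
  by rewrite -[leRHS]mulr1 ler_pM.
by rewrite ler_pM // hzw.
Qed.

End SmallValues.


(** * The exponential on the real torus *)

Section ComplexExponential.
Variable R : realType.
Local Notation C := (complex R).

Lemma cexp2piD (s t : R) : cexp2pi (s + t) = cexp2pi s * cexp2pi t.
Proof.
rewrite /cexp2pi mulrDr cosD sinD; apply/eqP; rewrite eq_complex /=.
by rewrite eqxx [X in _ == X]addrC eqxx.
Qed.

Lemma norm_cexp2pi (t : R) : `|cexp2pi t| = 1.
Proof. by rewrite normc_def /= cos2Dsin2 sqrtr1. Qed.

Lemma cexp2pi_neq0 (t : R) : cexp2pi t != 0.
Proof. by rewrite -normr_eq0 norm_cexp2pi oner_eq0. Qed.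

Lemma torus_pt_in_torus d (k : 'rV[R]_d) : in_torus (torus_pt k).
Proof. by move=> j; apply: cexp2pi_neq0. Qed.

Lemma cexp2pi_neq1 (t : R) : 0 < t < 1 -> cexp2pi t != 1.
Proof.
move=> /andP[t0 t1]; apply/eqP => -[/eqP + _]; apply/negP.
have -> : 2 * pi * t = (pi * t) *+ 2 by rewrite mulr2n; ring.
have : 0 < sin (pi * t).
  by rewrite sin_gt0_pi // mulr_gt0 ?pi_gt0 //= gtr_pMr // pi_gt0.
rewrite cos_mulr2n cos2sin2 => h; apply/eqP => e.
have : sin (pi * t) ^+ 2 > 0 by rewrite exprn_gt0.
lra.
Qed.

Lemma cexp2pi_frac_inj M : injective (fun t : 'I_M => cexp2pi (t%:R / M%:R : R)).
Proof.
have key (t u : 'I_M) : (t < u)%N ->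
    cexp2pi (t%:R / M%:R : R) != cexp2pi (u%:R / M%:R).
  move=> tu; apply/eqP => e.
  have M0 : 0 < M%:R :> R by rewrite ltr0n (leq_ltn_trans _ (ltn_ord u)).
  have : 0 < (u - t)%:R / (M%:R : R) < 1.
    rewrite divr_gt0 // ?ltr0n ?subn_gt0 //= ltr_pdivrMr // mul1r ltr_nat.
    exact: leq_ltn_trans (leq_subr _ _) (ltn_ord u).
  move=> /cexp2pi_neq1/eqP; apply.
  apply: (mulfI (cexp2pi_neq0 (t%:R / M%:R))); rewrite -cexp2piD mulr1 e.
  by congr cexp2pi; rewrite -mulrDl -natrD subnKC // ltnW.
move=> t u e; apply: val_inj; case: (ltngtP t u) => // h.
  by have := key _ _ h; rewrite e eqxx.
by have := key _ _ h; rewrite e eqxx.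
Qed.

Lemma cexp2pi_near1 (eta : C) : 0 < eta ->
  exists2 N : nat, (0 < N)%N &
    forall s : R, 0 <= s <= N%:R^-1 -> `|cexp2pi s - 1| <= eta.
Proof.
move=> eta0.
have [e ee] : exists e : R, eta = e%:C%C.
  by have /complex_realP[e ->] := gtr0_real eta0; exists e.
have e0 : 0 < e by move: eta0; rewrite ee ltcR.
have e20 : 0 < e / 2 by rewrite divr_gt0.
have H (f : R -> R) : {for 0, continuous f} ->
    \forall s \near (0 : R), `|f 0 - f s| <= e / 2.
  by move=> cf; apply: (@cvgr_dist_le _ _ _ _ _ _ _ cf).
have Hs : {for 0, continuous (fun s : R => sin (2 * pi * s))}.
  apply: continuous_comp; last exact: continuous_sin.
  exact: mulrl_continuous.
have Hc : {for 0, continuous (fun s : R => cos (2 * pi * s))}.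
  apply: continuous_comp; last exact: continuous_cos.
  exact: mulrl_continuous.
have := filterI (H _ Hs) (H _ Hc).
rewrite !mulr0 sin0 cos0 => near0.
have [r /= r0 hr] := (nbhs_ballP _ _).1 (near0 _).
have [N hN] : exists N : nat, r^-1 < N%:R.
  by exists (Num.truncn r^-1).+1; rewrite truncnS_gt.
have N0 : (0 < N)%N.
  by rewrite -(ltr0n R) (lt_trans _ hN) // invr_gt0.
exists N => // s /andP[s0 sN].
have [] := hr s.
  rewrite /ball /= sub0r normrN ger0_norm // (le_lt_trans sN) //.
  by rewrite -[r]invrK ltf_pV2 // posrE ?invr_gt0 // ltr0n.
rewrite sub0r normrN => h1 h2.
rewrite ee normc_def lecR /= oppr0 addr0.
have e0' : 0 <= e by exact: ltW.
rewrite -[leRHS](ger0_norm e0') -sqrtr_sqr ler_wsqrtr //.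
rewrite distrC in h2.
rewrite addrC -(real_normK (num_real (sin _))) -(real_normK (num_real (cos _ - 1))).
have := normr_ge0 (sin (2 * pi * s)); have := normr_ge0 (cos (2 * pi * s) - 1).
move: h1 h2; set x := `|_|; set y := `|_|; nra.
Qed.

End ComplexExponential.

(** * Null sets, and nullity of the zero set of a polynomial on the real torus *)

Section NullSets.
Variables (R : realType) (d : nat).
Hypothesis d0 : (0 < d)%N.
Implicit Types (S : 'rV[R]_d -> Prop).

Definition vol (a b : 'rV[R]_d) : R := \prod_(j < d) (b 0 j - a 0 j).

Lemma vol_ge0 (a b : 'rV[R]_d) : (forall j, a 0 j <= b 0 j) -> 0 <= vol a b.
Proof. by move=> ab; apply: prodr_ge0 => j _; rewrite subr_ge0. Qed.

(** For d = 0 the empty product would be 1. Degenerate boxes are the padding in the covers below. *)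
Lemma vol0 (a : 'rV[R]_d) : vol a a = 0.
Proof.
by rewrite /vol (bigD1 (Ordinal d0)) //= subrr mul0r.
Qed.

Lemma null_subset S S' : (forall k, S k -> S' k) ->
  lebesgue_null S' -> lebesgue_null S.
Proof.
move=> h n eps e0; have [a [b [ab [hS hs]]]] := n eps e0.
by exists a, b; split=> //; split=> // k /h /hS.
Qed.

Lemma null_of_finite_covers S :
  (forall eps : R, 0 < eps -> exists s : seq ('rV[R]_d * 'rV[R]_d),
    [/\ forall x j, x \in s -> x.1 0 j <= x.2 0 j,
        forall k, S k -> exists2 x, x \in s & forall j, x.1 0 j <= k 0 j <= x.2 0 j
      & \sum_(x <- s) vol x.1 x.2 <= eps]) ->
  lebesgue_null S.
Proof.
move=> H eps e0; have [s [hs hc hv]] := H eps e0.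
pose x n := nth (0, 0) s n.
have xle n j : (x n).1 0 j <= (x n).2 0 j.
  have [h|h] := ltnP n (size s); first by apply: hs; apply: mem_nth.
  by rewrite /x nth_default.
exists (fun n => (x n).1), (fun n => (x n).2); split; first exact: xle.
split=> [k /hc[y ys hy]|N].
  by exists (index y s) => j; rewrite /x nth_index.
apply: le_trans hv; rewrite (big_nth (0, 0)) big_mkord.
apply: (@le_trans _ _ (\sum_(0 <= n < size s + N) vol (x n).1 (x n).2)).
  rewrite addnC -(big_mkord xpredT (fun n => vol (x n).1 (x n).2)).
  rewrite [leRHS](@big_cat_nat _ _ _ N) ?leq_addr //= lerDl sumr_ge0 // => n _.
  exact: vol_ge0.
rewrite (@big_cat_nat _ _ _ (size s)) ?leq_addr //= big_mkord gerDl.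
rewrite big_nat big1 // => n /andP[h _].
by rewrite /x nth_default //= vol0.
Qed.

Lemma sum_half_pow n : \sum_(i < n) (2^-1 : R) ^+ i.+1 <= 1.
Proof.
suff -> : \sum_(i < n) (2^-1 : R) ^+ i.+1 = 1 - 2^-1 ^+ n.
  by rewrite gerBl exprn_ge0 // invr_ge0.
elim: n => [|n IH]; first by rewrite big_ord0 expr0 subrr.
rewrite big_ord_recr /= IH exprS; lra.
Qed.

Lemma null_bigcup (S : nat -> 'rV[R]_d -> Prop) :
  (forall n, lebesgue_null (S n)) -> lebesgue_null (fun k => exists n, S n k).
Proof.
move=> hS eps e0.
have en n : 0 < eps * 2^-1 ^+ n.+1 by rewrite mulr_gt0 // exprn_gt0 // invr_gt0.
pose ab n := cid (hS n _ (en n)); pose a n := sval (ab n).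
pose ab' n := cid (svalP (ab n)); pose b n := sval (ab' n).
have ple n i j : a n i 0 j <= b n i 0 j by case: (svalP (ab' n)) => h _; apply: h.
have pcov n k : S n k -> exists i, forall j, a n i 0 j <= k 0 j <= b n i 0 j.
  by case: (svalP (ab' n)) => _ [h _]; apply: h.
have psum n N : \sum_(i < N) vol (a n i) (b n i) <= eps * 2^-1 ^+ n.+1.
  by case: (svalP (ab' n)) => _ [_ h]; apply: h.
(* All boxes are renumbered along the coding of pairs of integers; a number that codes no pair gets
   the degenerate box at 0. *)
pose A m := if pickle_inv m is Some (n, i) then a n i else 0.
pose B m := if pickle_inv m is Some (n, i) then b n i else 0.
exists A, B; split.
  by move=> m j; rewrite /A /B; case: pickle_inv => // -[n i].
split=> [k [n /pcov[i hi]]|N].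
  by exists (pickle (n, i)) => j; rewrite /A /B pickleK_inv.
(* The first N codes lie in a finite square of pairs, so the partial sum is bounded by a finite
   double sum. *)
have [K hK] : exists K, forall m, (m < N)%N ->
    if pickle_inv m is Some (n, i) then ((n < K) && (i < K))%N else true.
  elim: N => [|N [K hK]]; first by exists 0%N.
  case E : (pickle_inv N : option (nat * nat)) => [[n i]|].
    exists (maxn K (maxn n i).+1) => m; rewrite ltnS leq_eqVlt => /orP[/eqP ->|mN].
      by rewrite E !leq_max !ltnS !leq_max !leqnn !orbT.
    have := hK m mN; case: pickle_inv => // -[n' i'] /andP[h1 h2].
    by rewrite !leq_max h1 h2.
  exists K => m; rewrite ltnS leq_eqVlt => /orP[/eqP ->|]; last exact: hK.
  by rewrite E.
apply: (@le_trans _ _ (\sum_(n < K) \sum_(i < K) vol (a n i) (b n i))); last first.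
  apply: (@le_trans _ _ (\sum_(n < K) eps * 2^-1 ^+ n.+1)).
    by apply: ler_sum => n _; apply: psum.
  by rewrite -mulr_sumr -[leRHS]mulr1 ler_pM2l // sum_half_pow.
(* Each volume is spread over the square by an indicator, so that after exchanging sums each pair is
   counted at most once. *)
have E (m : 'I_N) : vol (A m) (B m) = \sum_(n < K) \sum_(i < K)
    if pickle (nat_of_ord n, nat_of_ord i) == m then vol (a n i) (b n i) else 0.
  have := hK m (ltn_ord m); rewrite /A /B.
  case E : (pickle_inv (nat_of_ord m) : option (nat * nat)) => [[n i]|].
    move=> /andP[nK iK].
    have em : pickle (n, i) = m.
      by have := @pickle_invK (nat * nat)%type m; rewrite E.
    rewrite (bigD1 (Ordinal nK)) //= (bigD1 (Ordinal iK)) //= em eqxx.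
    rewrite !big1 ?addr0 // => [n' hn'|i' hi'].
      apply: big1 => i' _; case: eqP => // e; case/eqP: hn'.
      apply: val_inj => /=; have := congr1 pickle_inv (etrans e (esym em)).
      by move=> /(_ (nat * nat)%type); rewrite !pickleK_inv => -[].
    case: eqP => // e; case/eqP: hi'.
    apply: val_inj => /=; have := congr1 pickle_inv (etrans e (esym em)).
    by move=> /(_ (nat * nat)%type); rewrite !pickleK_inv => -[].
  move=> _; rewrite vol0 big1 // => n _; apply: big1 => i _.
  case: eqP => // e; move: E; rewrite -e.
  by rewrite pickleK_inv.
rewrite (eq_bigr _ (fun m _ => E m)) exchange_big /=; apply: ler_sum => n _.
rewrite exchange_big /=; apply: ler_sum => i _.
have [h|h] := ltnP (pickle (nat_of_ord n, nat_of_ord i)) N; last first.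
  rewrite big1 ?vol_ge0 // => m _; case: eqP => // e.
  by move: h; rewrite e leqNgt ltn_ord.
rewrite (bigD1 (Ordinal h)) //= eqxx big1 ?addr0 // => m hm.
by case: eqP => // e; case/eqP: hm; apply: val_inj.
Qed.

Local Notation C := (complex R).

(** The cover keeps the cells of side 1 / N whose corner gives r a small value. The choices are made
    in this order: D from r, M from D and eps, the threshold [dl] from M, and the refinement N' from
    [dl]. *)
Lemma zero_cube_null (r : iter_poly C d) (x0 : 'rV[R]_d) : r != 0 ->
  lebesgue_null (fun k : 'rV[R]_d => teval (torus_pt k) r = 0 /\
                          forall j, x0 0 j <= k 0 j < x0 0 j + 1).
Proof.
move=> r0; apply: null_of_finite_covers => eps e0.
have [D hD] := grid_small_count r0.
have [M M0 DM] : exists2 M : nat, (0 < M)%N & D%:R / M%:R <= eps.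
  exists (Num.truncn (D%:R / eps)).+1 => //.
  rewrite ler_pdivrMr ?ltr0n // mulrC -ler_pdivrMr //.
  exact/ltW/truncnS_gt.
pose rt (t : 'I_M) : C := cexp2pi (t%:R / M%:R : R).
have [|dl dl0 hdl] := hD M rt (@cexp2pi_frac_inj _ M).
  by move=> t; apply: norm_cexp2pi.
have [B [L [_ L0 hL]]] := ieval_lipschitz r.
have L1 : 0 < L + 1 by rewrite ltr_wpDl.
(* [L + 1] is used since [L] may be zero. *)
have eta0 : 0 < dl / (L + 1) by rewrite divr_gt0.
have Ldl : L * (dl / (L + 1)) <= dl.
  by rewrite mulrA ler_pdivrMr // mulrC ler_pM2l // lerDl.
have [N' N'0 hN'] := cexp2pi_near1 eta0.
set N := (M * N')%N.
have N0 : (0 < N)%N by rewrite muln_gt0 M0.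
have NR0 : 0 < N%:R :> R by rewrite ltr0n.
pose z (i : {ffun 'I_d -> 'I_N'}) : nat -> C :=
  extend (torus_pt (\row_j (x0 0 j + (i j)%:R / N%:R))).
have nz i j : `|z i j| = 1.
  by rewrite /z /extend; case: insub => [k|]; rewrite ?norm_cexp2pi ?normr1.
pose T i := [set x : {ffun 'I_d -> 'I_M} | `|ieval d (grid_pt rt (z i) x) r| <= dl].
(* In each coordinate a cell number t is written x * N' + i, so t / N = x / M + i / N: for fixed i
   the corners form one coset of the M-th roots of unity. *)
pose a (y : {ffun 'I_d -> 'I_N'} * {ffun 'I_d -> 'I_M}) : 'rV[R]_d :=
  \row_j (x0 0 j + (y.1 j)%:R / N%:R + (y.2 j)%:R / M%:R).
pose b y : 'rV[R]_d := \row_j (a y 0 j + N%:R^-1).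
exists [seq (a y, b y) | y <- enum [set y | y.2 \in T y.1]]; split.
- by move=> x j /mapP[y _ ->] /=; rewrite [leRHS]mxE lerDl invr_ge0 ler0n.
- move=> k [rk hk]; pose t j := Num.truncn ((k 0 j - x0 0 j) * N%:R).
  have tle j : (t j)%:R <= (k 0 j - x0 0 j) * N%:R < (t j).+1%:R.
    apply: truncn_itv; rewrite mulr_ge0 ?ler0n // subr_ge0.
    by case/andP: (hk j).
  have tN j : (t j < M * N')%N.
    rewrite -(ltr_nat R); case/andP: (tle j) => h _; apply: le_lt_trans h _.
    rewrite gtr_pMl // ltrBlDl; by case/andP: (hk j).
  have iN j : (t j %% N' < N')%N by rewrite ltn_mod.
  have xM j : (t j %/ N' < M)%N by rewrite ltn_divLR.
  pose y := ([ffun j => Ordinal (iN j)] : {ffun 'I_d -> 'I_N'},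
             [ffun j => Ordinal (xM j)] : {ffun 'I_d -> 'I_M}).
  have aE j : a y 0 j = x0 0 j + (t j)%:R / N%:R.
    rewrite mxE !ffunE /= -addrA; congr (_ + _).
    rewrite [in RHS](divn_eq (t j) N') natrD natrM mulrDl addrC; congr (_ + _).
    by rewrite /N natrM -mulf_div divff ?mulr1 // pnatr_eq0 -lt0n.
  have kb j : 0 <= k 0 j - a y 0 j <= N%:R^-1.
    rewrite aE; case/andP: (tle j) => h1 h2; rewrite opprD addrA subr_ge0.
    rewrite ler_pdivrMr // h1 /=.
    have : k 0 j - x0 0 j <= (t j).+1%:R / N%:R by rewrite ler_pdivlMr // ltW.
    rewrite -natr1 mulrDl mul1r; lra.
  exists (a y, b y).
    apply/mapP; exists y => //; rewrite mem_enum !inE.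
    have gE (j : 'I_d) : grid_pt rt (z y.1) y.2 j = cexp2pi (a y 0 j).
      by rewrite /grid_pt /z valK extendE /torus_pt /rt -cexp2piD !mxE.
    have gn j : `|grid_pt rt (z y.1) y.2 j| <= 1.
      rewrite /grid_pt normrM nz mul1r; case: insub => [l|]; rewrite ?normr1 //.
      by rewrite norm_cexp2pi.
    have kn j : `|extend (torus_pt k) j| <= 1.
      by rewrite /extend; case: insub => [l|]; rewrite ?norm_cexp2pi ?normr1.
    (* r vanishes at k, and k is within 1 / N of the corner in each coordinate; so the value at the
       corner is at most L * eta, hence at most [dl], and the cell was kept. *)
    have [|_] := hL _ _ _ (ltW eta0) gn kn.
      move=> j jd; rewrite -[j]/(val (Ordinal jd)) gE extendE distrC.
      have /andP[s0 s1] := kb (Ordinal jd).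
      rewrite -[torus_pt k _](congr1 (@cexp2pi R) (subrK (a y 0 (Ordinal jd)) _)).
      rewrite cexp2piD -[X in _ - X]mul1r -mulrBl normrM norm_cexp2pi mulr1.
      apply: hN'; rewrite s0 (le_trans s1) // lef_pV2 ?posrE ?ltr0n //.
      by rewrite ler_nat leq_pmull.
    rewrite -/(teval _ _) rk subr0 => h; exact: le_trans h Ldl.
  move=> j /=; rewrite [b y 0 j]mxE; have := kb j; lra.
have volE y : vol (a y) (b y) = N%:R^-1 ^+ d.
  rewrite /vol (eq_bigr (fun=> N%:R^-1)) => [|j _]; last first.
    by rewrite [b y 0 j]mxE addrAC subrr add0r.
  by rewrite prodr_const card_ord.
rewrite big_map (eq_bigr (fun=> N%:R^-1 ^+ d)) => [|y _]; last exact: volE.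
rewrite big_enum /= sumr_const card_dep_pair -[leLHS]mulr_natl exprVn.
(* Each of the N'^d cosets keeps at most D * M^d / M cells, of volume 1 / (M * N')^d: the total is
   at most D / M. *)
apply: le_trans DM; rewrite ler_pdivrMr ?exprn_gt0 // mulrAC ler_pdivlMr ?ltr0n //.
rewrite -natrX -!natrM ler_nat mulnC big_distrr /=.
apply: (@leq_trans (\sum_(i : {ffun 'I_d -> 'I_N'}) D * M ^ d)%N).
  by apply: leq_sum => i _; apply: hdl (nz i).
by rewrite sum_nat_const card_ffun !card_ord /N expnMn mulnC mulnA.
Qed.

(** The space is the countable union of the unit cubes with integer corners, numbered by
    [pickle]. *)
Lemma zero_set_null (r : iter_poly C d) : r != 0 ->
  lebesgue_null (fun k : 'rV[R]_d => teval (torus_pt k) r = 0).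
Proof.
move=> r0.
pose x0 n : 'rV[R]_d :=
  if (unpickle n : option {ffun 'I_d -> int}) is Some m then \row_j (m j)%:~R else 0.
apply: null_subset (null_bigcup (fun n => zero_cube_null (x0 n) r0)) => k hk.
exists (pickle [ffun j => Num.floor (k 0 j)]); split=> // j.
rewrite /x0 pickleK mxE ffunE.
by have /andP[-> h] := floor_itv (k 0 j); rewrite intrD in h; rewrite h.
Qed.

End NullSets.


(** * The whole space is not null *)

Section CubeNotNull.
Variable R : realType.
Local Notation ind a b x := (\1_(`[a, b]%classic : set R) x : R).

Lemma lebesgue_measure_itvcc (a b : R) : a <= b ->
  lebesgue_measure (`[a, b]%classic : set R) = (b - a)%:E.
Proof.
move=> ab; rewrite lebesgue_measure_itv /= lte_fin.
by case: ltgtP ab => // -> _; rewrite subrr.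
Qed.

(* Slicing along the last coordinate turns the weight of a box meeting the slice
   into a new weight in one dimension less; Fubini is then a one-dimensional
   integration. *)
Lemma weighted_box_cover d (w : nat -> R) (a b : nat -> nat -> R) :
  (forall n, 0 <= w n) -> (forall n j, a n j <= b n j) ->
  (forall x : nat -> R, (forall j, 0 <= x j <= 1) ->
    (1 <= \sum_(0 <= n <oo)
            (w n * \prod_(0 <= j < d) ind (a n j) (b n j) (x j))%:E)%E) ->
  (1 <= \sum_(0 <= n <oo) (w n * \prod_(0 <= j < d) (b n j - a n j))%:E)%E.
Proof.
elim: d w => [|d IH] w w0 ab H.
  have h01 (j : nat) : 0 <= (0 : R) <= 1 by rewrite lexx ler01.
  apply: le_trans (H (fun=> 0) h01) _; rewrite le_eqVlt; apply/orP; left; apply/eqP.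
  by apply: eq_eseriesr => n _; rewrite !big_geq.
pose c n := w n * \prod_(0 <= j < d) (b n j - a n j).
have c0 n : 0 <= c n.
  by rewrite mulr_ge0 // prodr_ge0 // => j _; rewrite subr_ge0.
pose g n (t : measurableTypeR R) : \bar R := (ind (a n d) (b n d) t)%:E.
pose f n (t : measurableTypeR R) : \bar R := ((c n)%:E * g n t)%E.
have f0 n t : (0 <= f n t)%E by rewrite mule_ge0 // lee_fin // indicE ler0n.
have slice t : 0 <= t <= 1 -> (1 <= \sum_(0 <= n <oo) f n t)%E.
  move=> t01; apply: le_trans (IH (fun n => w n * ind (a n d) (b n d) t) _ ab _) _.
  - by move=> n; rewrite mulr_ge0 // indicE ler0n.
  - move=> x hx; pose y j := if (j < d)%N then x j else t.
    have hy j : 0 <= y j <= 1 by rewrite /y; case: ifP.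
    apply: le_trans (H y hy) _; rewrite le_eqVlt; apply/orP; left; apply/eqP.
    apply: eq_eseriesr => n _; congr (_%:E).
    rewrite big_nat_recr //= mulrA mulrAC /y ltnn; congr (_ * _ * _).
    by apply: eq_big_nat => j /andP[_ jd]; rewrite jd.
  rewrite le_eqVlt; apply/orP; left; apply/eqP; apply: eq_eseriesr => n _.
  by rewrite /f /g /c -EFinM mulrAC.
pose mu := @lebesgue_measure R.
have mind n : measurable_fun (`[0, 1]%classic : set (measurableTypeR R)) (g n).
  apply/measurable_EFinP/measurable_indic; exact: measurable_itv.
have mf n : measurable_fun (`[0, 1]%classic : set (measurableTypeR R)) (f n).
  exact: measurable_funeM.
have intf n : (\int[mu]_(t in (`[0%R, 1%R] : set (measurableTypeR R))%classic) f n t <=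
    (w n * \prod_(0 <= j < d.+1) (b n j - a n j))%:E)%E.
  rewrite ge0_integralZl_EFin //; last first.
    by move=> t _; rewrite lee_fin indicE ler0n.
  rewrite integral_indic //.
  have -> : w n * \prod_(0 <= j < d.+1) (b n j - a n j) = c n * (b n d - a n d).
    by rewrite big_nat_recr //= mulrA.
  rewrite [leRHS]EFinM; apply: lee_pmul => //; first by rewrite lee_fin.
    rewrite -(lebesgue_measure_itvcc (ab n d)).
    apply: le_measure; rewrite ?inE //; first exact: measurableI.
have : (\int[mu]_(t in (`[0%R, 1%R] : set (measurableTypeR R))%classic) cst 1%E t <=
    \int[mu]_(t in (`[0%R, 1%R] : set (measurableTypeR R))%classic) \sum_(0 <= n <oo) f n t)%E.
  apply: ge0_le_integral => //.
  exact: ge0_emeasurable_sum.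
rewrite integral_cst //= mul1e (lebesgue_measure_itvcc ler01) subr0.
move=> /le_trans; apply; rewrite integral_nneseries //.
apply: lee_nneseries => [n _ _|n _]; last exact: intf.
exact: integral_ge0.
Qed.

(** A cover of total volume 1/2 has indicator sum at least 1 at each point of the unit cube, which
    by [weighted_box_cover] forces total volume at least 1. *)
Lemma full_space_not_null d : ~ lebesgue_null (fun _ : 'rV[R]_d => True).
Proof.
move=> /(_ (2^-1) ltac:(by rewrite invr_gt0)) [a [b [ab [cov hs]]]].
(* Beyond the d coordinates the interval is [0, 1], which keeps [A n j <= B n j] for every index. *)
pose A n j := if insub j is Some i then a n 0 (i : 'I_d) else 0.
pose B n j := if insub j is Some i then b n 0 (i : 'I_d) else 1.
have AB n j : A n j <= B n j by rewrite /A /B; case: insub => [i|].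
suff : (1 <= \sum_(0 <= n <oo) (1 * \prod_(0 <= j < d) (B n j - A n j))%:E)%E.
  apply/negP; rewrite -ltNge; apply: (@le_lt_trans _ _ (2^-1)%:E); last first.
    by rewrite lte_fin; lra.
  apply: lime_le.
    apply: is_cvg_nneseries => n _ _; rewrite lee_fin mul1r prodr_ge0 // => j _.
    by rewrite subr_ge0.
  apply: nearW => N; rewrite big_mkord sumEFin lee_fin; apply: le_trans (hs N).
  rewrite le_eqVlt; apply/orP; left; apply/eqP; apply: eq_bigr => n _.
  rewrite mul1r big_mkord; apply: eq_bigr => j _.
  by rewrite /A /B valK.
apply: weighted_box_cover => // x hx.
have [n hn] := cov (\row_j x j) I.
pose g n := ((1 * \prod_(0 <= j < d) ind (A n j) (B n j) (x j))%:E).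
have g0 m : (0 <= g m)%E.
  by rewrite lee_fin mul1r prodr_ge0 // => j _; rewrite indicE ler0n.
apply: (@le_trans _ _ (\sum_(0 <= m < n.+1) g m)%E); last exact: nneseries_lim_ge.
rewrite big_nat_recr //= -[leLHS]add0e; apply: leeD; first exact: sume_ge0.
rewrite lee_fin mul1r big_mkord big1 // => j _.
rewrite indicE mem_set // /A /B valK /= in_itv /=.
by have := hn j; rewrite mxE.
Qed.

End CubeNotNull.


(** * Eigenvalues of Hermitian matrices *)

Section Eigenvalues.
Variables (R : realType) (Q : nat).
Local Notation C := (complex R).
Implicit Type M : 'M[C]_Q.

(** For a row eigenvector v, a times the squared norm of v is the Hermitian form v M v^*, which
    equals its own conjugate. *)
Lemma hermitian_root_real M (a : C) : hermitian_mx M ->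
  root (char_poly M) a -> a = ((complex.Re a)%:C)%C.
Proof.
move=> hM; rewrite -eigenvalue_root_char => /eigenvalueP[v va v0].
pose s := \sum_j `|v 0 j| ^+ 2.
have s0 : s != 0.
  apply: contraNneq v0 => /eqP; rewrite psumr_eq0 => [/allP h|j _]; last first.
    by rewrite exprn_ge0.
  apply/eqP/rowP => j; rewrite mxE; have := h j (mem_index_enum _) .
  by rewrite sqrf_eq0 normr_eq0 => /eqP.
have E : a * s = \sum_j \sum_i v 0 i * M i j * ((v 0 j)^*)%C.
  rewrite /s mulr_sumr; apply: eq_bigr => j _; rewrite sqr_normc mulrA.
  have := congr1 (fun u : 'rV_Q => u 0 j) va; rewrite !mxE => <-.
  by rewrite mulr_suml.
have sc : (s^*)%C = s.
  rewrite /s rmorph_sum; apply: eq_bigr => j _.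
  by rewrite sqr_normc rmorphM /= conjcK mulrC.
have Ec : (a^*)%C * s = a * s.
  rewrite -[in LHS]sc -rmorphM E rmorph_sum [RHS]exchange_big /=; apply: eq_bigr => j _.
  rewrite rmorph_sum /=; apply: eq_bigr => i _.
  by rewrite !rmorphM /= conjcK -hM mulrC mulrA mulrAC.
move/(mulIf s0): Ec; case: a {E va} => x y /= [/eqP]; rewrite eq_sym -addr_eq0.
by rewrite -mulr2n mulrn_eq0 /= => /eqP ->.
Qed.

(** [S1] and [S2] ask for the existence of ordered eigenvalue lists, so showing that a point belongs
    to them requires such a list. *)
Lemma hermitian_ordered_eigenvalues M : hermitian_mx M ->
  exists ev, ordered_eigenvalues M ev.
Proof.
move=> hM; have [r er] := closed_field_poly_normal (char_poly M).
rewrite (monicP (char_poly_monic M)) scale1r in er.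
have hr z : z \in r -> z = ((complex.Re z)%:C)%C.
  by move=> zr; apply: (hermitian_root_real hM); rewrite er root_prod_XsubC.
pose t := sort <=%R (map (@complex.Re R) r).
have st : size t = Q.
  rewrite size_sort size_map; have := size_char_poly M.
  by rewrite er size_prod_XsubC => -[].
exists (fun i => t`_i); split=> [i j ij|].
  apply: (sorted_leq_nth le_trans lexx) => //; rewrite ?inE ?st ?ltn_ord //.
  exact/sort_le_sorted.
have -> : \prod_(i < Q) ('X - (((t`_i)%:C)%C : C)%:P) =
          \prod_(x <- t) ('X - ((x%:C)%C : C)%:P).
  by rewrite (big_nth 0) big_mkord st.
rewrite (perm_big (map (@complex.Re R) r)) /=; last by rewrite perm_sort.
by rewrite big_map er; apply: eq_big_seq => z /hr {1}->.
Qed.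

Lemma PA_char_poly d (A : 'M[('I_d -> C) -> C]_Q) z lam :
  PA A z lam = (-1) ^+ Q * (char_poly (mx_eval A z)).[lam].
Proof.
rewrite /PA /char_poly -horner_evalE -det_map_mx -detZ; congr (\det _).
apply/matrixP => i j; rewrite !mxE /=.
by rewrite /horner_eval hornerD hornerN hornerC hornerMn hornerX mulN1r opprB.
Qed.

End Eigenvalues.


(** Bezout over the fraction field with denominators cleared. The constant r takes the place of a
    resultant, or of a discriminant when q is the derivative of p. *)
Lemma bezout_const (R : idomainType) (p q : {poly R}) :
  p != 0 -> ~~ (1 < size (gcdp p q))%N ->
  exists r u v, r != 0 /\ r%:P = u * p + v * q.
Proof.
move=> p0; rewrite -leqNgt => sg.
have [[u v] /= /eqpP[[c1 c2] /= /andP[c10 c20] e]] := Bezoutp p q.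
exists (c2 * (gcdp p q)`_0), (c1 *: u), (c1 *: v); split.
  rewrite mulf_neq0 // -polyC_eq0 -size1_polyC //.
  by rewrite gcdp_eq0 negb_and p0.
by rewrite polyCM -size1_polyC // mul_polyC -e scalerDr !scalerAl.
Qed.

Lemma deriv_prod_root (F : fieldType) (I : finType) (f : I -> {poly F}) i0 x :
  root (f i0) x ->
  (\prod_i f i)^`().[x] = (f i0)^`().[x] * \prod_(i | i != i0) (f i).[x].
Proof.
move=> /eqP fx; rewrite (bigD1 i0) //= derivM hornerD !hornerM fx mul0r addr0.
by rewrite horner_prod.
Qed.

(** * Rotation of the torus preserves irreducible and normalized elements *)

Section Rotation.
Variables (R : realType) (d : nat).
Local Notation C := (complex R).
Implicit Types (f : ('I_d -> C) -> C) (F G : ('I_d -> C) -> C -> C).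

Definition rot (zeta : 'I_d -> C) F : ('I_d -> C) -> C -> C :=
  fun z lam => F (fun j => zeta j * z j) lam.

Lemma in_torusM (zeta z : 'I_d -> C) :
  in_torus zeta -> in_torus z -> in_torus (fun j => zeta j * z j).
Proof. by move=> hzeta hz j; rewrite mulf_neq0. Qed.

Lemma in_torusV (zeta : 'I_d -> C) :
  in_torus zeta -> in_torus (fun j => (zeta j)^-1).
Proof. by move=> hzeta j; rewrite invr_neq0. Qed.

Lemma rotK zeta F : in_torus zeta -> rot zeta (rot (fun j => (zeta j)^-1) F) = F.
Proof.
move=> hz; apply/funext => z; apply/funext => lam; rewrite /rot; congr (F _ _).
by apply/funext => j; rewrite mulKf // hz.
Qed.

Lemma rotVK zeta F : in_torus zeta -> rot (fun j => (zeta j)^-1) (rot zeta F) = F.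
Proof.
move=> hz; apply/funext => z; apply/funext => lam; rewrite /rot; congr (F _ _).
by apply/funext => j; rewrite mulVKf // hz.
Qed.

Lemma laurent_rot zeta f : in_torus zeta -> is_laurent f ->
  is_laurent (fun z => f (fun j => zeta j * z j)).
Proof.
move=> hzeta [s hs].
exists [seq (t.1 * laurent_monomial t.2 zeta, t.2) | t <- s] => z hz.
rewrite hs; last exact: in_torusM.
rewrite big_map; apply: eq_bigr => t _ /=; rewrite -mulrA; congr (_ * _).
rewrite /laurent_monomial -big_split /=; apply: eq_bigr => j _.
by rewrite expfzMl.
Qed.

Lemma LP_rot zeta F : in_torus zeta -> is_LP F -> is_LP (rot zeta F).
Proof.
move=> hzeta [n [c [hc hF]]].
exists n, (fun i z => c i (fun j => zeta j * z j)); split=> [i|z lam hz].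
  exact: laurent_rot.
by rewrite /rot hF //; exact: in_torusM.
Qed.

Lemma LP_monic_rot zeta F : in_torus zeta -> LP_monic F -> LP_monic (rot zeta F).
Proof.
move=> hzeta [n [c [hc hF]]].
exists n, (fun i z => c i (fun j => zeta j * z j)); split=> [i|z lam hz].
  exact: laurent_rot.
by rewrite /rot hF //; exact: in_torusM.
Qed.

Lemma LP_unit_rot zeta F : in_torus zeta -> LP_unit F -> LP_unit (rot zeta F).
Proof.
move=> hzeta [hF [G [hG FG]]]; split; first exact: LP_rot.
exists (rot zeta G); split; first exact: LP_rot.
by move=> z lam hz; apply: FG; apply: in_torusM.
Qed.

Lemma LP_irreducible_rot zeta F : in_torus zeta ->
  LP_irreducible F -> LP_irreducible (rot zeta F).
Proof.
move=> hzeta [hF nu irr]; have hzeta' := in_torusV hzeta; split.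
- exact: LP_rot.
- by move=> /(LP_unit_rot hzeta'); rewrite rotVK.
move=> G H hG hH e.
have [] := irr _ _ (LP_rot hzeta' hG) (LP_rot hzeta' hH).
- move=> z lam hz; rewrite -{1}[F](rotVK F hzeta).
  by rewrite {1}/rot e //; exact: in_torusM.
- by move=> /(LP_unit_rot hzeta); rewrite rotK //; left.
by move=> /(LP_unit_rot hzeta); rewrite rotK //; right.
Qed.

End Rotation.

(** * Polynomials in z that detect common and double roots in lambda *)

Section Discriminants.
Variables (R : realType) (d : nat).
Local Notation C := (complex R).
Local Notation poly_d := (iter_poly C d).
Implicit Types (F G : ('I_d -> C) -> C -> C).

Lemma no_common_root F G :
  LP_irreducible F -> LP_monic F -> LP_irreducible G -> LP_monic G ->
  ~ LP_eq F G ->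
  exists2 r : poly_d, r != 0 & forall z, in_torus z ->
    forall lam, F z lam = 0 -> G z lam = 0 -> teval z r = 0.
Proof.
move=> iF /LP_monic_numer[n [M [p [hp _ lp _]]]].
move=> iG /LP_monic_numer[n' [N [q [hq _ lq _]]]] FG.
have p0 : p != 0 by rewrite -size_poly_gt0 ltnW // (irreducible_monic_size iF hp).
have [|r [u [v [r0 e]]]] := @bezout_const _ p q p0.
  by apply/negP => sg; apply: FG; apply: LP_irreducible_eq hp hq lp lq sg.
exists r => // z hz lam F0 G0.
have := congr1 (fun s => (peval z s).[lam]) e.
rewrite rmorphD !rmorphM hornerD !hornerM -hp // -hq // F0 G0 !mulr0 addr0.
by rewrite /peval /= map_polyC hornerC.
Qed.

(** F depends on lambda as a mere function; its derivative is taken on a polynomial [f] with the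
    same values, which is the specialized numerator up to a nonzero scalar. *)
Lemma no_double_root F : LP_irreducible F -> LP_monic F ->
  exists2 r : poly_d, r != 0 & forall z, in_torus z ->
    forall (f : {poly C}) lam, (forall x, f.[x] = F z x) ->
    root f lam -> root f^`() lam -> teval z r = 0.
Proof.
move=> iF /LP_monic_numer[n [M [p [hp _ lp _]]]].
have p0 : p != 0 by rewrite -size_poly_gt0 ltnW // (irreducible_monic_size iF hp).
have [r [u [v [r0 e]]]] := bezout_const p0 (LP_irreducible_separable iF hp lp).
exists r => // z hz f lam hf f0 f1.
have ef : peval z p = prod_coord z ^+ M *: f.
  by apply: polyCeq => x; rewrite hornerZ hf hp.
have := congr1 (fun s => (peval z s).[lam]) e.
rewrite rmorphD !rmorphM hornerD !hornerM /= -deriv_map -/(peval z) ef.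
rewrite derivZ !hornerZ (eqP f0) (eqP f1) !mulr0 addr0.
by rewrite map_polyC hornerC.
Qed.

Lemma finite_exceptional (I : finType) (B : I -> ('I_d -> C) -> Prop) :
  (forall i, exists2 r : poly_d, r != 0 & forall z, B i z -> teval z r = 0) ->
  exists2 r : poly_d, r != 0 & forall z, (exists i, B i z) -> teval z r = 0.
Proof.
move=> h; have [r hr] := choice (fun i => let: ex_intro2 r a b := h i in
  ex_intro (fun r => r != 0 /\ forall z, B i z -> teval z r = 0) r (conj a b)).
exists (\prod_i r i); first by apply/prodf_neq0 => i _; case: (hr i).
move=> z [i Bi]; rewrite rmorph_prod (bigD1 i) //=.
by rewrite (hr i).2 // mul0r.
Qed.

Lemma LP_monic_poly F z : LP_monic F -> LP_irreducible F -> in_torus z ->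
  exists2 f : {poly C}, forall x, f.[x] = F z x & (1 < size f)%N.
Proof.
move=> /LP_monic_numer[n [M [p [hp sp lp sz]]]] iF hz.
have m0 : (prod_coord z ^+ M)^-1 != 0.
  by rewrite invr_neq0 // expf_neq0 // prod_coord_neq0.
exists ((prod_coord z ^+ M)^-1 *: peval z p).
  by move=> x; rewrite hornerZ -hp // mulKf // -invr_eq0.
by rewrite size_scale // sz // -sp (irreducible_monic_size iF hp).
Qed.

End Discriminants.

(** * From coinciding eigenvalues to coinciding factors, and back *)

Section Main.
Variables (R : realType) (d Q : nat).
Local Notation C := (complex R).

Lemma ordered_eigenvalues_root (M : 'M[C]_Q) ev lam :
  ordered_eigenvalues M ev -> root (char_poly M) lam ->
  exists s, lam = ((ev s)%:C)%C.
Proof.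
move=> [_ ->]; rewrite /root horner_prod => /prodf_eq0[s _].
by rewrite hornerXsubC subr_eq0 => /eqP; exists s.
Qed.

Lemma root_ordered_eigenvalues (M : 'M[C]_Q) ev s :
  ordered_eigenvalues M ev -> root (char_poly M) ((ev s)%:C)%C.
Proof.
move=> [_ ->]; rewrite /root horner_prod (bigD1 s) //=.
by rewrite hornerXsubC subrr mul0r.
Qed.

Lemma repeated_eigenvalue (M : 'M[C]_Q) ev s : ordered_eigenvalues M ev ->
  (exists w, s != w /\ ev s = ev w) <->
  root (char_poly M)^`() ((ev s)%:C)%C.
Proof.
move=> [_ ->]; rewrite /root (@deriv_prod_root _ _ _ s); last first.
  by rewrite root_XsubC.
rewrite derivXsubC hornerC mul1r; split=> [[w [sw e]]|/prodf_eq0[w ws]].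
  by apply/prodf_eq0; exists w; rewrite 1?eq_sym // hornerXsubC e subrr.
rewrite hornerXsubC subr_eq0 => /eqP/complexI e.
by exists w; rewrite eq_sym.
Qed.

Variables (A : 'M[('I_d -> C) -> C]_Q) (K : nat) (P : 'I_K -> ('I_d -> C) -> C -> C).
Hypothesis hP : irreducible_factorization A P.
Hypothesis hherm : forall k : 'rV[R]_d, hermitian_mx (Ak A k).

Lemma char_poly_horner z lam : in_torus z ->
  (char_poly (mx_eval A z)).[lam] = \prod_l P l z lam.
Proof.
move=> hz; have := hP.2 z lam hz; rewrite PA_char_poly.
by apply: mulfI; rewrite expf_neq0 // oppr_eq0 oner_eq0.
Qed.

Lemma root_char_poly z lam : in_torus z ->
  root (char_poly (mx_eval A z)) lam <-> exists l, P l z lam = 0.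
Proof.
move=> hz; rewrite /root char_poly_horner //.
split=> [/prodf_eq0[l _ /eqP]|[l hl]]; first by exists l.
by apply/prodf_eq0; exists l => //; rewrite hl.
Qed.

Lemma char_poly_factors z : in_torus z -> exists f : 'I_K -> {poly C},
  (forall l x, (f l).[x] = P l z x) /\ char_poly (mx_eval A z) = \prod_l f l.
Proof.
move=> hz; have hf l : exists f : {poly C}, forall x, f.[x] = P l z x.
  have [irr mon] := hP.1 l.
  by have [f hf _] := LP_monic_poly mon irr hz; exists f.
have [f fP] := choice hf; exists f; split=> //.
apply: polyCeq => x; rewrite char_poly_horner // horner_prod.
by apply: eq_bigr => l _.
Qed.

Lemma factor_has_root l z : in_torus z -> exists lam, P l z lam = 0.
Proof.
move=> hz; have [irr mon] := hP.1 l.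
have [f hf sf] := LP_monic_poly mon irr hz.
have /closed_rootP[x /eqP hx] : size f != 1%N by rewrite neq_ltn sf orbT.
by exists x; rewrite -hf.
Qed.

Lemma torus_ptD (k alpha : 'rV[R]_d) :
  torus_pt (k + alpha) = (fun j => torus_pt alpha j * torus_pt k j).
Proof.
by apply/funext => j; rewrite /torus_pt mxE cexp2piD mulrC.
Qed.

Lemma condition_C_null (alpha : 'rV[R]_d) : (0 < d)%N ->
  condition_C alpha P -> lebesgue_null (S1 A alpha).
Proof.
move=> d0 hC; have hzeta := torus_pt_in_torus alpha.
have [|r r0 hr] := @finite_exceptional R d ('I_K * 'I_K)%type (fun l z =>
    in_torus z /\ exists2 lam, P l.1 z lam = 0 & rot (torus_pt alpha) (P l.2) z lam = 0).
  move=> [l1 l2] /=; have [i1 m1] := hP.1 l1; have [i2 m2] := hP.1 l2.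
  have [r r0 hr] := no_common_root i1 m1 (LP_irreducible_rot hzeta i2)
    (LP_monic_rot hzeta m2) (hC l1 l2).
  by exists r => // z [hz [lam h1 h2]]; apply: hr h1 h2.
apply: null_subset (zero_set_null d0 r0) => k [ev1 [ev2 [h1 [h2 [s [w e]]]]]].
have hk := torus_pt_in_torus k.
have /(root_char_poly _ (torus_pt_in_torus _)) [l2 hl2] := root_ordered_eigenvalues s h1.
have /(root_char_poly _ hk) [l1 hl1] := root_ordered_eigenvalues w h2.
apply: hr; exists (l1, l2); split=> //; exists ((ev2 w)%:C)%C => //=.
by rewrite /rot -torus_ptD -e.
Qed.

Lemma null_condition_C (alpha : 'rV[R]_d) :
  lebesgue_null (S1 A alpha) -> condition_C alpha P.
Proof.
move=> hN zeta l1 l2 e; apply: (@full_space_not_null R d).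
apply: null_subset hN => k _; have hk := torus_pt_in_torus k.
have [lam h1] := factor_has_root l1 hk.
have [ev1 he1] := hermitian_ordered_eigenvalues (hherm (k + alpha)).
have [ev2 he2] := hermitian_ordered_eigenvalues (hherm k).
have /(ordered_eigenvalues_root he2)[w ew] : root (char_poly (Ak A k)) lam.
  by apply/(root_char_poly _ hk); exists l1.
have /(ordered_eigenvalues_root he1)[s es] : root (char_poly (Ak A (k + alpha))) lam.
  apply/(root_char_poly _ (torus_pt_in_torus _)); exists l2.
  by rewrite torus_ptD -e.
exists ev1, ev2; split=> //; split=> //; exists s, w.
by apply: complexI; rewrite -es -ew.
Qed.

(** At a repeated eigenvalue the derivative of the product of factors vanishes. Hence a factor that
    is zero there has a double root, detected by [r2], or shares its root with a factor of another
    index, detected by [r1]. *)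
Lemma square_free_null : (0 < d)%N -> square_free P -> lebesgue_null (S2 A).
Proof.
move=> d0 hS.
have [|r1 r10 hr1] := @finite_exceptional R d ('I_K * 'I_K)%type (fun l z =>
    [/\ in_torus z, l.1 != l.2 & exists2 lam, P l.1 z lam = 0 & P l.2 z lam = 0]).
  move=> [l1 l2] /=; have [i1 m1] := hP.1 l1; have [i2 m2] := hP.1 l2.
  have [<-|l12] := eqVneq l1 l2.
    (* Pairs of equal indices are excluded by the predicate, so nothing has to be detected for
       them. *)
    by exists 1; rewrite ?oner_neq0 // => z [].
  have [r r0 hr] := no_common_root i1 m1 i2 m2 (hS _ _ l12).
  by exists r => // z [hz _ [lam h1 h2]]; apply: hr h1 h2.
have [|r2 r20 hr2] := @finite_exceptional R d 'I_K (fun l z =>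
    in_torus z /\ exists f lam,
      [/\ forall x, f.[x] = P l z x, root f lam & root f^`() lam]).
  move=> l; have [i1 m1] := hP.1 l; have [r r0 hr] := no_double_root i1 m1.
  by exists r => // z [hz [f [lam [h1 h2 h3]]]]; apply: hr h1 h2 h3.
have r0 : r1 * r2 != 0 by rewrite mulf_neq0.
apply: null_subset (zero_set_null d0 r0) => k [ev [he [s [w [sw e]]]]].
have hk := torus_pt_in_torus k; rewrite rmorphM /=.
have [f [fP cf]] := char_poly_factors hk.
set lam := ((ev s)%:C)%C.
have /(root_char_poly _ hk) [l hl] := root_ordered_eigenvalues s he.
have fl : root (f l) lam by rewrite /root fP hl.
have : root (char_poly (Ak A k))^`() lam.
  by apply/(repeated_eigenvalue s he); exists w.
rewrite /root cf (deriv_prod_root fl) mulf_eq0 => /orP[h|/prodf_eq0[l' ll' /eqP h]].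
  rewrite (hr2 (torus_pt k)) ?mulr0 //; exists l; split=> //.
  by exists (f l), lam; split=> // x; rewrite fP.
rewrite (hr1 (torus_pt k)) ?mul0r //; exists (l, l'); split; rewrite //= 1?eq_sym //.
by exists lam; rewrite // -fP.
Qed.

Lemma null_square_free : lebesgue_null (S2 A) -> square_free P.
Proof.
move=> hN l1 l2 l12 e; apply: (@full_space_not_null R d).
apply: null_subset hN => k _; have hk := torus_pt_in_torus k.
have [lam h1] := factor_has_root l1 hk.
have [ev he] := hermitian_ordered_eigenvalues (hherm k).
have [f [fP cf]] := char_poly_factors hk.
have /(ordered_eigenvalues_root he)[s es] : root (char_poly (Ak A k)) lam.
  by apply/(root_char_poly _ hk); exists l1.
have fl : root (f l1) lam by rewrite /root fP h1.
exists ev; split=> //; exists s; apply/(repeated_eigenvalue s he); rewrite -es.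
rewrite /root cf (deriv_prod_root fl) (bigD1 l2) 1?eq_sym //= fP -e // h1.
by rewrite mul0r mulr0.
Qed.

End Main.

Theorem theorem1 (R : realType) (d Q : nat) (hd : (0 < d)%N) (hQ : (0 < Q)%N)
    (A : 'M[('I_d -> complex R) -> complex R]_Q)
    (hA : forall i j, is_laurent (A i j))
    (hherm : forall k : 'rV[R]_d, hermitian_mx (Ak A k))
    (K : nat) (P : 'I_K -> ('I_d -> complex R) -> complex R -> complex R)
    (hP : irreducible_factorization A P)
    (alpha : 'rV[R]_d) (halpha : exists j, alpha 0 j \notin Num.int) :
  (condition_C alpha P <-> lebesgue_null (S1 A alpha)) /\
  (square_free P <-> lebesgue_null (S2 A)).
Proof.
split; split.
- exact: condition_C_null.
- exact: null_condition_C.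
- exact: square_free_null.
exact: null_square_free.
Qed.
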